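(* Let $O\subset\mathbb{R}^d$ be a non-empty Greenian open set, and let $\mu,\vartheta$ be positive Borel measures on $O$ with compact supports in $O$ such that $\mu$ is an $\operatorname{sbh}(O)$-balayage of $\vartheta$. If $E$ is a polar set, then $$\mu\bigl((O\cap E)\setminus\operatorname{supp}\vartheta\bigr)=0.$$
   Context: $d\ge1$. An open set is Greenian if it possesses a Green function (equivalently, each of its connected components carries a non-constant positive superharmonic function). $\operatorname{sbh}(O)$ is the class of all subharmonic functions $O\to[-\infty,+\infty)$ (locally convex if $d=1$), including the function identically $-\infty$. Measures with compact support are Radon, hence finite. The convention $0\cdot(\pm\infty)=0$ is used. Polar sets are understood in the usual sense of classical potential theory (sets on which some subharmonic function, not identically $-\infty$ on any component of its domain, equals $-\infty$); if $E$ is not Borel, the equality means that the set is $\mu$-null, i.e. contained in a Borel set of $\mu$-measure zero. Balayage: for measures $\vartheta,\mu$ on $O$ and a class $H$ of Borel functions on $O$ whose integrals against $\vartheta$ and $\mu$ are well defined with values in $[-\infty,+\infty]$, $\mu$ is an $H$-balayage of $\vartheta$ if $\int h\,d\vartheta\le\int h\,d\mu$ for all $h\in H$. *)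

(* Defs.v *)
From HB Require Import structures.
From mathcomp Require Import all_boot all_order all_algebra.
From mathcomp Require Import lra.
From mathcomp Require Import all_classical all_reals all_analysis.
From mathcomp Require Import measurable_realfun.

Set Implicit Arguments.
Unset Strict Implicit.
Unset Printing Implicit Defensive.
Import Order.TTheory GRing.Theory Num.Theory.
Import numFieldNormedType.Exports.
Local Open Scope classical_set_scope.
Local Open Scope ring_scope.

(* R^d is 'rV[R]_d with R : realType. *)

(* The Borel sigma-algebra: generated by the open sets. *)
HB.instance Definition _ (R : realType) (d : nat) :=
  Measurable.copy 'rV[R]_d (g_sigma_algebraType (@open 'rV[R]_d)).

Section borel_rV.
Context {R : realType}.

Lemma open_measurable_rV d (A : set 'rV[R]_d) : open A -> measurable A.
Proof. by move=> oA; exact: sub_sigma_algebra. Qed.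

Lemma continuous_measurable_rV d (f : 'rV[R]_d -> R) :
  continuous f -> measurable_fun [set: 'rV[R]_d] f.
Proof.
move=> cf; apply: (measurability _ (RGenOpens.measurableE R)).
move=> _ [_ [a [b ->] <-]]; rewrite setTI; apply: open_measurable_rV.
by apply: open_comp => [x _|]; [exact: cf|exact: interval_open].
Qed.

Lemma continuous_measurable_rV2 d n (f : 'rV[R]_d -> 'rV[R]_n) :
  continuous f -> measurable_fun [set: 'rV[R]_d] f.
Proof.
move=> cf; apply: (@measurability _ _ _ _ setT f (@open 'rV[R]_n)) => //.
move=> _ [U oU <-]; rewrite setTI; apply: open_measurable_rV.
by apply: open_comp => // x _; exact: cf.
Qed.

Definition row_cons d (p : R * 'rV[R]_d) : 'rV[R]_d.+1 :=
  row_mx (const_mx p.1 : 'rV[R]_1) p.2.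

Lemma measurable_row_cons d :
  measurable_fun [set: R * 'rV[R]_d] (@row_cons d).
Proof.
apply: (@measurability _ _ _ _ setT _ (@open 'rV[R]_d.+1)) => //.
move=> _ [U oU <-]; rewrite setTI.
pose r n : R := n.+1%:R^-1.
pose B (i : rat * 'rV[rat]_d * nat) : set (R * 'rV[R]_d) :=
  ball (ratr i.1.1 : R) (r i.2) `*`
  ball (map_mx ratr i.1.2 : 'rV[R]_d) (r i.2).
pose D := [set i | B i `<=` @row_cons d @^-1` U].
have -> : @row_cons d @^-1` U = \bigcup_(i in D) B i.
  apply/seteqP; split=> [p Up|p [i /= Di]]; last exact: Di.
  have /nbhs_ballP[e /= e0 eU] : nbhs (row_cons p) U by exact: open_nbhs_nbhs.
  have [n ne] : exists n, r n < e / 2.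
    exists (Num.trunc (e / 2)^-1); rewrite /r invf_plt ?posrE ?divr_gt0//.
    exact: truncnS_gt.
  have rn0 : 0 < r n by rewrite invr_gt0.
  have [q _ qp] : exists2 q : rat, True & ball (ratr q : R) (r n) p.1.
    have /rat_in_itvoo[q] : p.1 - r n < p.1 + r n by lra.
    by rewrite in_itv/= => /andP[? ?]; exists q => //; rewrite /ball/= ltr_norml; lra.
  have [v vp] : exists v : 'rV[rat]_d, ball (map_mx ratr v : 'rV[R]_d) (r n) p.2.
    have /choice[f fP] : forall j, exists q : rat, ball (ratr q : R) (r n) (p.2 ord0 j).
      move=> j.
      have /rat_in_itvoo[q'] : p.2 ord0 j - r n < p.2 ord0 j + r n by lra.
      by rewrite in_itv/= => /andP[? ?]; exists q'; rewrite /ball/= ltr_norml; lra.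
    exists (\row_j f j); split => // i j; rewrite !mxE (ord1 i); exact: fP.
  exists (q, v, n); last by [].
  move=> [a b] /= [/= qa vb]; apply: eU.
  have tri (c x y : R) : ball c (r n) x -> ball c (r n) y -> ball x e y.
    by rewrite /ball/= !ltr_norml; lra.
  split=> // i j; rewrite (ord1 i) /row_cons !mxE/=.
  case: (@fintype.split 1 d j) => k; first by rewrite !mxE; exact: tri qp qa.
  by rewrite /=; case: vp => _ /(_ ord0 k) vp; case: vb => _ /(_ ord0 k) vb;
     exact: tri vp vb.
rewrite bigcup_mkcond; apply: countable_bigcupT_measurable => [|i]; first exact: countableP.
case: ifPn => // _; apply: measurableX; first exact: measurable_ball.
by apply: open_measurable_rV; apply: ball_open; rewrite invr_gt0.
Qed.

Lemma sigma_finite_row_cons d (mu : {sigma_finite_measure set 'rV[R]_d -> \bar R}) :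
  sigma_finite setT (pushforward (lebesgue_measure \x mu)%E (@row_cons d)).
Proof.
pose uncons (q : 'rV[R]_d.+1) : measurableTypeR R * 'rV[R]_d :=
  (q ord0 ord0, rsubmx (q : 'rV_(1 + d))).
have unconsK : cancel uncons (@row_cons d).
  move=> q; rewrite /row_cons/= -[RHS](hsubmxK (q : 'rV_(1 + d))).
  congr (row_mx _ _ : 'rV_(1 + d)); apply/rowP => k; rewrite !mxE.
  by congr (q _ _); apply/val_inj; rewrite (ord1 k).
have row_consK : cancel (@row_cons d) uncons.
  move=> [a b]; rewrite /uncons /row_cons row_mxKr; congr pair.
  have := row_mxEl (const_mx a : 'rV[R]_1) b ord0 ord0.
  rewrite [in X in _ = X]mxE => E; rewrite -[RHS]E/=.
  by congr (fun_of_matrix _ _ _); apply/val_inj.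
have muncons : measurable_fun setT uncons.
  apply: measurable_fun_pair.
    by apply: continuous_measurable_rV => x; exact: coord_continuous.
  apply: continuous_measurable_rV2 => x A /nbhs_ballP[e /= e0 eA].
  apply/nbhs_ballP; exists e => // y [_ xy]; apply: eA; split=> // i j.
  by rewrite !mxE; exact: xy.
have /sigma_finiteP[F [TF ndF Foo]] := sigma_finiteT (@lebesgue_measure R).
have /sigma_finiteP[G [TG ndG Goo]] := sigma_finiteT mu.
exists (fun n => uncons @^-1` (F n `*` G n)).
  apply/esym; rewrite -subTset => q _.
  have [[m _ Fq] [n _ Gq]] : (\bigcup_i F i) (uncons q).1 /\
      (\bigcup_i G i) (uncons q).2 by rewrite -TF -TG.
  exists (maxn m n) => //; split.
  - by move: (uncons q).1 Fq; exact/subsetPset/ndF/leq_maxl.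
  - by move: (uncons q).2 Gq; exact/subsetPset/ndG/leq_maxr.
move=> n; have [mF Fn] := Foo n; have [mG Gn] := Goo n; split.
  by rewrite -[X in measurable X]setTI; apply: muncons => //; exact: measurableX.
rewrite /pushforward -comp_preimage (_ : _ \o _ = id); last exact/funext.
by rewrite preimage_id product_measure1E// lte_mul_pinfty// ge0_fin_numE.
Qed.

Section lebesgue_step.
Variables (d : nat) (mu : {sigma_finite_measure set 'rV[R]_d -> \bar R}).

Definition lebesgue_step : set 'rV[R]_d.+1 -> \bar R :=
  pushforward (lebesgue_measure \x mu)%E (@row_cons d).

HB.instance Definition _ := Measure.copy lebesgue_step
  (@measure_function_pushforward__canonical__measure_function_Measure
     _ _ _ _ R (lebesgue_measure \x mu)%E _ (@measurable_row_cons d)).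

HB.instance Definition _ := Measure_isSigmaFinite.Build _ _ _ lebesgue_step
  (sigma_finite_row_cons mu).

End lebesgue_step.

End borel_rV.

(* d-dimensional Lebesgue measure, as an iterated product. *)
Fixpoint lebesgue_rV (R : realType) (d : nat) :
    {sigma_finite_measure set 'rV[R]_d -> \bar R} :=
  if d is d'.+1 then lebesgue_step (lebesgue_rV R d') else \d_(0 : 'rV[R]_0).


(* The norm |.| carried by 'rV[R]_d in the library is the sup norm. *)
Definition enorm (R : realType) (d : nat) (x : 'rV[R]_d) : R :=
  Num.sqrt (\sum_(i < d) x ord0 i ^+ 2).

Definition eball (R : realType) (d : nat) (a : 'rV[R]_d) (r : R) :
  set 'rV[R]_d := [set x | enorm (x - a) < r].

Definition closed_eball (R : realType) (d : nat) (a : 'rV[R]_d) (r : R) :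
  set 'rV[R]_d := [set x | enorm (x - a) <= r].

Definition ball_mean (R : realType) (d : nat) (u : 'rV[R]_d -> \bar R)
    (a : 'rV[R]_d) (r : R) : \bar R :=
  ((fine (lebesgue_rV R d (eball a r)))^-1%:E *
   \int[lebesgue_rV R d]_(x in eball a r) u x)%E.

(* The values of u outside U are irrelevant.  The function may be identically
   -oo on U or on some of its connected components.  For d = 1 these are the
   locally convex functions (or -oo). *)
Definition subharmonic (R : realType) (d : nat) (U : set 'rV[R]_d)
    (u : 'rV[R]_d -> \bar R) : Prop :=
  [/\ forall x, U x -> (u x < +oo)%E,
      forall x, U x -> forall a : R,
        (u x < a%:E)%E -> \forall y \near x, (u y < a%:E)%E
    & forall x r, 0 < r -> closed_eball x r `<=` U ->
        (u x <= ball_mean u x r)%E].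

Definition sbh (R : realType) (d : nat) (U : set 'rV[R]_d) :
  set ('rV[R]_d -> \bar R) := [set u | subharmonic U u].

Definition harmonic (R : realType) (d : nat) (U : set 'rV[R]_d)
    (h : 'rV[R]_d -> R) : Prop :=
  (forall x, U x -> {for x, continuous h}) /\
  (forall x r, 0 < r -> closed_eball x r `<=` U ->
     (h x)%:E = ball_mean (EFin \o h) x r).

(* The fundamental superharmonic function of R^d with pole 0, for d >= 1. *)
Definition fundamental (R : realType) (d : nat) (x : 'rV[R]_d) : \bar R :=
  if (d <= 1)%N then (- enorm x)%:E
  else if x == 0 then +oo%E
  else if d == 2%N then (- ln (enorm x))%:E
  else (enorm x ^- (d - 2))%:E.

Definition greatest_harmonic_minorant (R : realType) (d : nat)
    (U : set 'rV[R]_d) (f : 'rV[R]_d -> \bar R) (h : 'rV[R]_d -> R) : Prop :=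
  [/\ harmonic U h,
      forall x, U x -> ((h x)%:E <= f x)%E
    & forall k, harmonic U k -> (forall x, U x -> ((k x)%:E <= f x)%E) ->
        forall x, U x -> k x <= h x].

(* Fundamental function minus its greatest harmonic minorant on U;
   G x y is the Green function of U at x with pole y. *)
Definition green_function (R : realType) (d : nat) (U : set 'rV[R]_d)
    (G : 'rV[R]_d -> 'rV[R]_d -> \bar R) : Prop :=
  forall y, U y -> exists h : 'rV[R]_d -> R,
    greatest_harmonic_minorant U (fun x => fundamental (x - y)) h /\
    forall x, U x -> G x y = (fundamental (x - y) - (h x)%:E)%E.

Definition greenian (R : realType) (d : nat) (U : set 'rV[R]_d) : Prop :=
  exists G : 'rV[R]_d -> 'rV[R]_d -> \bar R, green_function U G.

Definition polar (R : realType) (d : nat) (E : set 'rV[R]_d) : Prop :=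
  exists (U : set 'rV[R]_d) (u : 'rV[R]_d -> \bar R),
    [/\ open U, E `<=` U, subharmonic U u,
        forall x, U x ->
          exists2 y, connected_component U x y & u y <> -oo%E
      & forall x, E x -> u x = -oo%E].

(* A measure with compact support in an open set O is represented by its
   extension by 0 to R^d, i.e. by a measure mu on R^d with supp mu `<=` O. *)
Definition supp (R : realType) (d : nat) (mu : set 'rV[R]_d -> \bar R) :
  set 'rV[R]_d := [set x | forall V, open V -> V x -> mu V <> 0%E].

(* [mu] is an H-balayage of [theta] on O.  It is meant for classes H whose
   members have well-defined integrals against both measures; this holds for
   sbh O and finite measures with compact support in O, the members of sbh O
   being bounded above on compact subsets of O. *)
Definition balayage (R : realType) (d : nat) (O : set 'rV[R]_d)
    (H : set ('rV[R]_d -> \bar R))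
    (theta mu : {measure set 'rV[R]_d -> \bar R}) : Prop :=
  forall h, H h ->
    (\int[theta]_(x in O) h x <= \int[mu]_(x in O) h x)%E.

(* Main.v *)
(* If u is subharmonic near a and mu sweeps theta, then testing the balayage
   inequality against the smoothed fundamental functions with pole x shows that
   the smoothed potentials of mu are bounded above near a, uniformly in the
   smoothing scale s, as soon as a is off the support of theta.  A measure with
   bounded potential does not charge {u = -oo}: subtracting the potential of mu
   and a multiple of |x - a|^2 from a constant and taking the positive part
     gives
   a compactly supported psi >= 0 whose mean over the ball B(y, s) is at least
   psi(y) plus c s^2 (s^-d mu(B(y, s)) - const).  Integrating this against
   v = M - u >= 0, which dominates its means and is integrable near a, cancels
   the psi terms and leaves a bound, uniform in s, for
     int s^-d mu(B(y, s)) v(y) dy = int s^-d (int_B(w, s) v) dmu(w).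
   Since v is lower semicontinuous, s^-d int_B(w, s) v tends to +oo as s -> 0
   where u(w) = -oo, and Fatou's lemma gives the conclusion. *)

Require Import Defs.
From mathcomp Require Import all_boot all_order all_algebra.
From mathcomp Require Import ring lra.
From mathcomp Require Import all_classical all_reals all_analysis.
From mathcomp Require Import measurable_realfun.
Import Order.TTheory GRing.Theory Num.Theory.
Import numFieldNormedType.Exports.
Local Open Scope classical_set_scope.
Local Open Scope ring_scope.

Set Implicit Arguments.
Unset Strict Implicit.
Unset Printing Implicit Defensive.

(** * Lebesgue measure on R^d *)

(** [u] is known only through upper semicontinuity and the submean inequality over Euclidean balls,
    so it is never differentiated and no Riesz measure is formed. All calculus is done on explicit
    radial kernels, and it reaches [u] only through ball averages, which Tonelli moves from one
    factor to the other because [y] is within [s] of [x] exactly when [x] is within [s] of [y]. The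
    kernel [newton (s^2) - newton (|x - w|^2 + s^2)] is smooth at the pole, so its mean excess over
    a ball can be computed by integrating by parts along coordinate lines; it is also nonnegative,
    so its integrals against [mu] can be exchanged freely. Using the same [s] for smoothing and for
    averaging makes its Laplacian of order [s^-d] on the whole averaging ball around a nearby pole.
    For d >= 2 the constant [newton (s^2)] blows up as s -> 0. It can be absorbed because [mu] has
    at most the mass of [theta], which is the balayage inequality for the constant function -1. The
    multiple of |x - a|^2 serves to make the test function vanish far from [a]; its Laplacian is
    constant, so it costs an error that stays bounded relative to the other terms. *)

Section iterated_integral.
Context {R : realType}.
Local Open Scope ereal_scope.
Local Notation lam := (@lebesgue_measure R).

Lemma measurable_row_consE d :
  measurable_fun [set: measurableTypeR R * 'rV[R]_d] (@row_cons R d).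
Proof. exact: measurable_row_cons. Qed.

Lemma ge0_integral_row_cons d (f : 'rV[R]_d.+1 -> \bar R) :
  measurable_fun setT f -> (forall x, 0 <= f x) ->
  \int[lebesgue_rV R d.+1]_x f x =
  \int[(lam \x lebesgue_rV R d)]_p f (row_cons p).
Proof.
move=> mf f0.
have := @ge0_integral_pushforward _ _ _ _ R _ (@measurable_row_consE d)
  (lam \x lebesgue_rV R d) setT f measurableT.
by rewrite preimage_setT; apply => //; move=> x _; exact: f0.
Qed.

Lemma measurable_iter d (f : 'rV[R]_d.+1 -> \bar R) :
  measurable_fun setT f -> (forall x, 0 <= f x) ->
  measurable_fun [set: R] (fun s =>
    \int[lebesgue_rV R d]_z f (row_cons (s, z))).
Proof.
move=> mf f0.
apply: (@measurable_fun_fubini_tonelli_F _ _ (measurableTypeR R) _ R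
  (lebesgue_rV R d) (f \o @row_cons R d)) => [|x]; last exact: f0.
by apply: measurableT_comp => //; exact: measurable_row_consE.
Qed.

Lemma measurable_row_cons2 d s (f : 'rV[R]_d.+1 -> \bar R) :
  measurable_fun setT f -> measurable_fun setT (fun z => f (row_cons (s, z))).
Proof.
move=> mf.
apply: (measurableT_comp mf).
exact: measurableT_comp (@measurable_row_consE d) (pair1_measurable (T1 :=
  measurableTypeR R) s).
Qed.

Lemma ge0_integral_iter d (f : 'rV[R]_d.+1 -> \bar R) :
  measurable_fun setT f -> (forall x, 0 <= f x) ->
  \int[lebesgue_rV R d.+1]_x f x =
  \int[lam]_s \int[lebesgue_rV R d]_z f (row_cons (s, z)).
Proof.
move=> mf f0; rewrite ge0_integral_row_cons//.
have mfr : measurable_fun [set: measurableTypeR R * 'rV[R]_d] (f \o @row_cons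
  R d).
  by apply: measurableT_comp => //; exact: measurable_row_consE.
have := @fubini_tonelli1 _ _ (measurableTypeR R) _ R lam (lebesgue_rV R d)
  (f \o @row_cons R d) mfr.
by apply => p; exact: f0.
Qed.

Lemma integrable_row_cons d (f : 'rV[R]_d.+1 -> \bar R) :
  (lebesgue_rV R d.+1).-integrable setT f ->
  (lam \x lebesgue_rV R d).-integrable setT (f \o @row_cons R d).
Proof.
move=> /integrableP[mf fi]; apply/integrableP; split.
  by apply: measurableT_comp => //; exact: measurable_row_consE.
rewrite -(ge0_integral_row_cons (f := fun x => `|f x|))//.
exact: measurableT_comp.
Qed.

Lemma integral_row_cons d (f : 'rV[R]_d.+1 -> \bar R) :
  (lebesgue_rV R d.+1).-integrable setT f ->
  \int[lebesgue_rV R d.+1]_x f x =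
  \int[(lam \x lebesgue_rV R d)]_p f (row_cons p).
Proof.
move=> fi; have /integrableP[mf _] := fi.
have := @integral_pushforward _ _ _ _ R _ (@measurable_row_consE d)
  (lam \x lebesgue_rV R d) setT f mf.
by rewrite preimage_setT; apply => //; exact: integrable_row_cons.
Qed.

Definition upd d (i : 'I_d) (z : 'rV[R]_d) (s : R) : 'rV[R]_d :=
  \row_j (if j == i then s else z ord0 j).

Lemma row_cons0 d (p : R * 'rV[R]_d) : row_cons p ord0 ord0 = p.1.
Proof.
rewrite /row_cons.
have := row_mxEl (const_mx p.1 : 'rV[R]_1) p.2 ord0 ord0.
rewrite [in X in _ = X]mxE => E; rewrite -[RHS]E/=.
by congr (fun_of_matrix _ _ _); exact/val_inj.
Qed.

Lemma row_consS d (p : R * 'rV[R]_d) (j : 'I_d) :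
  row_cons p ord0 (lift ord0 j) = p.2 ord0 j.
Proof.
rewrite /row_cons.
have := row_mxEr (const_mx p.1 : 'rV[R]_1) p.2 ord0 j.
by move=> E; rewrite -[RHS]E/=; congr (fun_of_matrix _ _ _); exact/val_inj.
Qed.

Lemma upd_row_cons0 d (s s' : R) (z : 'rV[R]_d) :
  upd ord0 (row_cons (s', z)) s = row_cons (s, z).
Proof.
apply/rowP => j; rewrite mxE; case: (unliftP ord0 j) => [k ->|->].
  by rewrite !row_consS.
by rewrite eqxx row_cons0.
Qed.

Lemma upd_row_consS d (s s' : R) (i : 'I_d) (z : 'rV[R]_d) :
  upd (lift ord0 i) (row_cons (s', z)) s = row_cons (s', upd i z s).
Proof.
apply/rowP => j; rewrite mxE; case: (unliftP ord0 j) => [k ->|->].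
  by rewrite !row_consS (inj_eq lift_inj)// !mxE.
by rewrite !row_cons0.
Qed.

(** Induction on the dimension by Fubini: the first coordinate becomes the inner variable when it is
    [i], and is frozen otherwise. A frozen slice is integrable only for almost every value, hence
    the almost-everywhere equality. This turns one-dimensional integrations by parts into identities
    over R^d. *)
Lemma integral_slice0 d (i : 'I_d) (f : 'rV[R]_d -> \bar R) :
  (lebesgue_rV R d).-integrable setT f ->
  (forall z, \int[lam]_s f (upd i z s) = 0) ->
  \int[lebesgue_rV R d]_x f x = 0.
Proof.
elim: d i f => [[]//|d IH] i f fi f0.
rewrite integral_row_cons//; have fi' := integrable_row_cons fi.
case: (unliftP ord0 i) f0 => [j ->|->] f0.
  rewrite -(integral12_prod_meas1 fi').
  rewrite (ae_eq_integral (cst 0)) ?integral0//.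
    exact: measurable_fubini_F fi'.
  have := ae_integrable1 fi'; apply: filterS => s si _ /=.
  apply: (IH j) => // z.
  by under eq_integral do rewrite /= -upd_row_consS.
rewrite -(integral21_prod_meas1 fi').
rewrite (eq_integral (cst 0)) ?integral0// => z _.
(* The coordinate 0 is a dummy: [upd] overwrites it. *)
rewrite /fubini_G /= -[RHS](f0 (row_cons (0%R, z))).
by apply: eq_integral => s _; rewrite upd_row_cons0.
Qed.

Lemma lebesgue_translate (a : R) (A : set R) : measurable A ->
  pushforward lam (fun x => x + a)%R A = lam A.
Proof.
move=> mA; apply/esym.
have mf : measurable_fun [set: measurableTypeR R] (fun x =>
  (x + a)%R : measurableTypeR R).
  by apply: measurable_funD => //; exact: measurable_cst.
apply: (@lebesgue_measure_unique R
  (@measure_function_pushforward__canonical__measure_function_Measure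
     _ _ _ _ R lam _ mf)) => //= _ [[b c]] _ <-.
rewrite /= /pushforward.
rewrite (_ : _ @^-1` _ = [set` `]b - a, c - a]%R]).
  rewrite !lebesgue_measure_itv/= !lte_fin ltrD2r; case: ifPn => // _.
  by rewrite -!EFinD; congr EFin; ring.
by apply/seteqP; split => x /=; rewrite !in_itv/= => /andP[? ?]; lra.
Qed.

Lemma ge0_integral_translate1 (a : R) (f : R -> \bar R) :
  measurable_fun setT f -> (forall x, 0 <= f x) ->
  \int[lam]_x f (x + a)%R = \int[lam]_x f x.
Proof.
move=> mf f0.
have mt : measurable_fun [set: measurableTypeR R]
    (fun x => (x + a)%R : measurableTypeR R).
  by apply: measurable_funD => //; exact: measurable_cst.
transitivity (\int[pushforward lam
    (fun x : measurableTypeR R => (x + a)%R : measurableTypeR R)]_x f x).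
  have := ge0_integral_pushforward mt lam (D := setT) (f := f) measurableT mf.
  by rewrite preimage_setT => E; rewrite E// => x _; exact: f0.
by apply: eq_measure_integral => // A mA _; exact: lebesgue_translate.
Qed.

Lemma continuous_translate d (a : 'rV[R]_d) : continuous (fun x : 'rV[R]_d =>
  x + a)%R.
Proof. by move=> x; apply: continuousD; [exact: id|exact: cst_continuous]. Qed.

(** Needed so that [vol] and [paraboloid_vol] do not depend on the centre of the ball. *)
Lemma ge0_integral_translate d (a : 'rV[R]_d) (f : 'rV[R]_d -> \bar R) :
  measurable_fun setT f -> (forall x, 0 <= f x) ->
  \int[lebesgue_rV R d]_x f (x + a)%R = \int[lebesgue_rV R d]_x f x.
Proof.
elim: d a f => [|d IH] a f mf f0.
  by apply: eq_integral => x _; congr f; apply/rowP => -[].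
have mfa : measurable_fun setT (fun x : 'rV[R]_d.+1 => f (x + a)%R).
  exact: measurableT_comp mf (continuous_measurable_rV2 (@continuous_translate
    _ a)).
rewrite (ge0_integral_iter mf f0) (ge0_integral_iter mfa)//.
pose a' := \row_j a ord0 (lift ord0 j).
have aE s z : (row_cons (s, z) + a = row_cons (s + a ord0 ord0, z + a'))%R.
  apply/rowP => j; case: (unliftP ord0 j) => [k ->|->].
    by rewrite mxE !row_consS !mxE.
  by rewrite mxE !row_cons0.
rewrite -(ge0_integral_translate1 (a ord0 ord0) (measurable_iter mf f0));
  last first.
  by move=> x; exact: integral_ge0.
apply: eq_integral => s _.
under eq_integral do rewrite aE.
rewrite (IH a' (fun z => f (row_cons (s + a ord0 ord0, z)%R)))//.
exact: (measurable_row_cons2 _ mf).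
Qed.

End iterated_integral.

(** * Euclidean balls and the order of magnitude of their volume *)

Section euclidean_balls.
Context {R : realType}.
Local Open Scope ereal_scope.

(** Balls are handled through the squared norm: it is polynomial, and comparisons of radii become
    linear in the squares. *)
Definition sqn d (x : 'rV[R]_d) : R := (\sum_i x ord0 i ^+ 2)%R.

Definition box d (a : 'rV[R]_d) (r : R) : set 'rV[R]_d :=
  [set x | forall i, (`|x ord0 i - a ord0 i| < r)%R].

Lemma continuous_sum (T : topologicalType) n (f : 'I_n -> T -> R) :
  (forall i, continuous (f i)) -> continuous (fun x => \sum_i f i x)%R.
Proof.
elim: n f => [|n IH] f cf x.
  under eq_fun do rewrite big_ord0; exact: cst_continuous.
under eq_fun do rewrite big_ord_recl.
by apply: cvgD; [exact: cf|exact: (IH (fun i => f (lift ord0 i)))].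
Qed.

Lemma measurable_coord d (i : 'I_d) :
  measurable_fun [set: 'rV[R]_d] (fun x => x ord0 i).
Proof. by apply: continuous_measurable_rV => x; exact: coord_continuous. Qed.

Lemma measurable_sqn d d' (T : measurableType d') (f g : T -> 'rV[R]_d) :
  measurable_fun setT f -> measurable_fun setT g ->
  measurable_fun setT (fun t => sqn (f t - g t)%R).
Proof.
move=> mf mg; rewrite /sqn.
under eq_fun do under eq_bigr do rewrite !mxE.
apply: measurable_sum => i; apply: measurable_funX.
by apply: measurable_funB; apply: measurableT_comp (measurable_coord i) _.
Qed.

Lemma measurable_box d (a : 'rV[R]_d) (r : R) : measurable (box a r).
Proof.
rewrite (_ : box a r =
  \bigcap_(i in [set: 'I_d]) [set x | (`|x ord0 i - a ord0 i| < r)%R]).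
  apply: fin_bigcap_measurable => // i _.
  have mc : measurable_fun setT (fun x : 'rV[R]_d => `|x ord0 i - a ord0 i|%R).
    apply: measurableT_comp => //; apply: measurable_funB => //.
    exact: measurable_coord.
  have := mc measurableT _ (measurable_itv `]-oo, r[%R).
  by rewrite setTI; congr measurable; apply/seteqP; split => x /=;
    rewrite in_itv.
by apply/seteqP; split => x /= h i; [move=> _; exact: h|exact: h].
Qed.

Lemma lebesgue_box d (a : 'rV[R]_d) (r : R) : (0 < r)%R ->
  lebesgue_rV R d (box a r) = ((r *+ 2) ^+ d)%:E.
Proof.
move=> r0; elim: d a => [|d IH] a.
  rewrite /= diracE mem_set//; by case.
pose a' := \row_j a ord0 (lift ord0 j).
rewrite /= /lebesgue_step /pushforward.
rewrite (_ : _ @^-1` _ = ball (a ord0 ord0) r `*` box a' r).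
  rewrite product_measure1E//; first last.
  - exact: measurable_box.
  - exact: measurable_ball.
  rewrite IH exprS EFinM; congr (_ * _).
  exact: (lebesgue_measure_ball _ (ltW r0)).
apply/seteqP; split => -[s z] /= h.
  split; first by have := h ord0; rewrite row_cons0/= /ball/= distrC.
  by move=> i; have := h (lift ord0 i); rewrite row_consS/= mxE.
move=> i; case: (unliftP ord0 i) => [k ->|->].
  by rewrite row_consS/=; have := h.2 k; rewrite mxE.
by rewrite row_cons0/=; have := h.1; rewrite /ball/= distrC.
Qed.

Lemma sqn_ge0 d (x : 'rV[R]_d) : (0 <= sqn x)%R.
Proof. by apply: sumr_ge0 => i _; exact: sqr_ge0. Qed.

Lemma sqnC d (x y : 'rV[R]_d) : sqn (x - y)%R = sqn (y - x)%R.
Proof. by apply: eq_bigr => i _; rewrite !mxE -sqrrN opprB. Qed.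

(** Coordinatewise this is the nonnegativity of a square. It replaces the triangle inequality
    everywhere below; the factors 2 account for the generous radii chosen there. *)
Lemma sqn_sub_le d (x y z : 'rV[R]_d) : 
  (sqn (x - z) <= 2 * sqn (x - y) + 2 * sqn (y - z))%R.
Proof.
rewrite /sqn !big_distrr -big_split/=; apply: ler_sum => i _; rewrite !mxE.
set u := x _ _; set v := y _ _; set w := z _ _.
have := sqr_ge0 ((u - v) - (v - w))%R; nra.
Qed.

Lemma enorm_lt d (x : 'rV[R]_d) (r : R) : (0 < r)%R ->
  (enorm x < r)%R = (sqn x < r ^+ 2)%R.
Proof.
move=> r0; rewrite /enorm -/(sqn x) -{1}(ger0_norm (ltW r0)) -sqrtr_sqr.
by rewrite ltr_sqrt// exprn_gt0.
Qed.

Lemma enorm_le d (x : 'rV[R]_d) (r : R) : (0 <= r)%R ->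
  (enorm x <= r)%R = (sqn x <= r ^+ 2)%R.
Proof.
move=> r0; rewrite /enorm -/(sqn x) -{1}(ger0_norm r0) -sqrtr_sqr.
by rewrite ler_sqrt// exprn_ge0.
Qed.

Lemma in_eball d (a x : 'rV[R]_d) (r : R) : (0 < r)%R ->
  eball a r x <-> (sqn (x - a) < r ^+ 2)%R.
Proof. by move=> r0; rewrite /eball/= enorm_lt. Qed.

Lemma measurable_eball d (a : 'rV[R]_d) (r : R) : (0 < r)%R ->
  measurable (eball a r).
Proof.
move=> r0.
have mc : measurable_fun setT (fun x : 'rV[R]_d => sqn (x - a)%R).
  by apply: measurable_sqn => //.
have := mc measurableT _ (measurable_itv `]-oo, (r ^+ 2)%R[%R).
rewrite setTI; congr measurable; apply/seteqP; split => x /=;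
  rewrite in_itv/= => h.
  exact/in_eball.
exact/in_eball.
Qed.

Lemma sqr_le_sqn d (x : 'rV[R]_d) i : (x ord0 i ^+ 2 <= sqn x)%R.
Proof. by rewrite /sqn (bigD1 i)//= lerDl sumr_ge0// => j _;
  exact: sqr_ge0. Qed.

Lemma eball_sub_box d (a : 'rV[R]_d) (r : R) : (0 < r)%R ->
  eball a r `<=` box a r.
Proof.
move=> r0 x /(in_eball _ _ r0) xr i.
rewrite -(ltr_pXn2r (n := 2))// ?nnegrE ?(ltW r0)// real_normK ?num_real//.
by apply: le_lt_trans xr; have := sqr_le_sqn (x - a)%R i; rewrite !mxE.
Qed.

(** The crude half-side r / d, instead of r / sqrt d, avoids a root: d (r / d)^2 = r^2 / d <= r^2.
    Only the order r^d of the resulting volume bound matters. *)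
Lemma box_sub_eball d (a : 'rV[R]_d) (r : R) : (0 < d)%N -> (0 < r)%R ->
  box a (r / d%:R) `<=` eball a r.
Proof.
move=> d0 r0 x xr; apply/in_eball => //.
have dR : (1 <= d%:R :> R)%R by rewrite ler1n.
have d0' : (0 < d%:R :> R)%R by lra.
apply: (@lt_le_trans _ _ (\sum_(i < d) (r / d%:R) ^+ 2)%R).
  rewrite /sqn; apply: ltr_sum => [|i _].
    by apply/hasP; exists (Ordinal d0); rewrite // mem_index_enum.
  rewrite !mxE -[ltLHS]real_normK ?num_real// ltr_pXn2r ?nnegrE ?divr_ge0
    ?(ltW r0)//.
rewrite sumr_const card_ord.
have -> : ((r / d%:R) ^+ 2 *+ d = r ^+ 2 * d%:R^-1)%R.
  by rewrite -[LHS]mulr_natr; field; lra.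
by rewrite ler_piMr ?sqr_ge0// invf_le1.
Qed.

Definition vol d (r : R) : R := fine (lebesgue_rV R d (eball 0%R r)).

Lemma indic_eballC d (x y : 'rV[R]_d) (r : R) : \1_(eball x r) y =
  \1_(eball y r) x :> R.
Proof.
rewrite !indicE; congr ((_ : bool)%:R)%R.
by apply/idP/idP => /set_mem; rewrite /eball/= /enorm -/(sqn _) => h;
  apply/mem_set; rewrite /eball/= /enorm -/(sqn _) sqnC.
Qed.

Lemma eball_ltoo d (a : 'rV[R]_d) (r : R) : (0 < r)%R ->
  lebesgue_rV R d (eball a r) < +oo.
Proof.
move=> r0; apply: le_lt_trans (ltry ((r *+ 2) ^+ d)%R).
rewrite -(lebesgue_box a r0); apply: le_measure; rewrite ?inE.
- exact: measurable_eball.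
- exact: measurable_box.
- exact: eball_sub_box.
Qed.

Lemma ge0_integral_eball_translate d (a : 'rV[R]_d) (r : R) (f : 'rV[R]_d ->
  \bar R) :
  (0 < r)%R -> measurable_fun setT f -> (forall x, 0 <= f x) ->
  \int[lebesgue_rV R d]_(x in eball a r) f (x - a)%R =
  \int[lebesgue_rV R d]_(x in eball 0%R r) f x.
Proof.
move=> r0 mf f0; rewrite integral_mkcond [RHS]integral_mkcond.
rewrite -(ge0_integral_translate (- a)%R (f := f \_ (eball 0%R r)));
  last 2 first.
- apply/(measurable_restrictT _ (measurable_eball _ r0)).
  exact: measurable_funTS.
- by move=> x; rewrite /patch; case: ifP.
apply: eq_integral => x _; rewrite /patch.
by congr (if _ then _ else _); apply/idP/idP => /set_mem h; apply/mem_set;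
  move: h;
  rewrite /eball/= subr0.
Qed.

Lemma lebesgue_eball d (a : 'rV[R]_d) (r : R) : (0 < r)%R ->
  lebesgue_rV R d (eball a r) = (vol d r)%:E.
Proof.
move=> r0; rewrite /vol fineK; last first.
  by rewrite ge0_fin_numE ?eball_ltoo.
have := @ge0_integral_eball_translate d a r (cst 1) r0.
rewrite !integral_cst ?mul1e//; try exact: measurable_eball.
by apply => //; exact: measurable_cst.
Qed.

Lemma integral_cst_eball d (a : 'rV[R]_d) (r k : R) : (0 < r)%R ->
  \int[lebesgue_rV R d]_(x in eball a r) k%:E = (k * vol d r)%:E.
Proof.
move=> r0; rewrite integral_cst; last exact: measurable_eball.
by rewrite EFinM; congr (_ * _); exact: lebesgue_eball.
Qed.

Lemma vol_ge d (r : R) : (0 < d)%N -> (0 < r)%R ->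
  ((2 * (r / d%:R)) ^+ d <= vol d r)%R.
Proof.
move=> d0 r0; rewrite -lee_fin -(lebesgue_eball 0%R r0).
have rd : (0 < r / d%:R)%R by rewrite divr_gt0// ltr0n.
rewrite mulr_natl -(lebesgue_box 0%R rd).
apply: le_measure; rewrite ?inE.
- exact: measurable_box.
- exact: measurable_eball.
- exact: box_sub_eball.
Qed.

Lemma vol_gt0 d (r : R) : (0 < d)%N -> (0 < r)%R -> (0 < vol d r)%R.
Proof.
move=> d0 r0; apply: lt_le_trans (vol_ge d0 r0).
by rewrite exprn_gt0// mulr_gt0// divr_gt0// ltr0n.
Qed.

End euclidean_balls.

(** * Mean values of radial functions *)

Section radial_slice.
Context {R : realType}.
Local Notation lam := (@lebesgue_measure R).

Lemma integral_is_derive (F f : R -> R) (a b : R) : a < b ->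
  (forall x : R, is_derive x 1 F (f x)) -> continuous f ->
  (\int[lam]_(x in `[a, b]) (f x)%:E = (F b - F a)%:E)%E.
Proof.
move=> ab Ff cf; rewrite (continuous_FTC2 (F := F))//.
- by apply: continuous_subspaceT.
- have cF : continuous F.
    by move=> x; apply/differentiable_continuous/derivable1_diffP; case: (Ff x).
  split=> [x _||]; first by case: (Ff x).
    exact/cvg_at_right_filter/cF.
  exact/cvg_at_left_filter/cF.
- by move=> x _; rewrite derive1E; case: (Ff x).
Qed.

Variables g1 g2 : R -> R.
Hypothesis dg1 : forall v : R, 0 <= v -> is_derive v 1 g1 (g2 v).
Hypothesis cg2 : forall v : R, 0 <= v -> {for v, continuous g2}.

Let cg1 (v : R) : 0 <= v -> {for v, continuous g1}.
Proof.
by move=> v0; apply/differentiable_continuous/derivable1_diffP; case: (dg1 v0).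
Qed.

(** The integrand is the derivative of [H], which carries the factor r^2 - (s - e)^2 and therefore
    vanishes at both endpoints. [D] stands for the contribution of the other coordinates, and [r]
    for the half-length of a chord of the ball. *)
Lemma integral_radial_slice (D e b t r : R) : 0 <= D -> 0 < r ->
  let W s := b + t * (s - e) in
  (\int[lam]_(s in `[(e - r)%R, (e + r)%R])
     (2 * (s - e) * W s * g1 (W s ^+ 2 + D) -
       t * (r ^+ 2 - (s - e) ^+ 2) *
         (g1 (W s ^+ 2 + D) + 2 * W s ^+ 2 * g2 (W s ^+ 2 + D)))%:E = 0)%E.
Proof.
move=> D0 r0 W.
have V0 s : 0 <= W s ^+ 2 + D by rewrite addr_ge0// sqr_ge0.
pose H s := - ((r ^+ 2 - (s - e) ^+ 2) * W s * g1 (W s ^+ 2 + D)).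
pose h s := 2 * (s - e) * W s * g1 (W s ^+ 2 + D) -
  t * (r ^+ 2 - (s - e) ^+ 2) *
    (g1 (W s ^+ 2 + D) + 2 * W s ^+ 2 * g2 (W s ^+ 2 + D)).
suff [dH ch] : (forall s : R, is_derive s 1 H (h s)) /\ continuous h.
  have err : e - r < e + r by lra.
  by rewrite (integral_is_derive err dH ch) /H; congr EFin; ring.
split.
  move=> s.
  have dW : is_derive s 1 W t by rewrite /W; apply: is_derive_eq;
    rewrite /GRing.scale/=; ring.
  have dV : is_derive s 1 (fun s => W s ^+ 2 + D) (2 * t * W s).
    by apply: is_derive_eq; rewrite /GRing.scale/=; ring.
  have dG : is_derive s 1 (fun s =>
    g1 (W s ^+ 2 + D)) (g2 (W s ^+ 2 + D) * (2 * t * W s)).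
    exact: (@is_derive1_comp R g1 (fun s =>
      W s ^+ 2 + D) s _ _ (dg1 (V0 s)) dV).
  by rewrite /H /h; apply: is_derive_eq; rewrite /GRing.scale/=; ring.
- have cW : continuous (fun s => b + t * (s - e)).
    move=> s; apply: cvgD; first exact: cvg_cst.
    apply: cvgM; first exact: cvg_cst.
    by apply: cvgB; [exact: cvg_id|exact: cvg_cst].
  have cW2 : continuous (fun s => W s ^+ 2).
    by move=> s; apply: cvgM; exact: cW.
  have cV : continuous (fun s => W s ^+ 2 + D).
    by move=> s; apply: cvgD; [exact: cW2|exact: cvg_cst].
  have cG1 : continuous (fun s => g1 (W s ^+ 2 + D)).
    by move=> s; apply: continuous_comp; [exact: cV|exact/cg1/V0].
  have cG2 : continuous (fun s => g2 (W s ^+ 2 + D)).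
    by move=> s; apply: continuous_comp; [exact: cV|exact/cg2/V0].
  have ce : continuous (fun s : R => s - e).
    by move=> s; apply: cvgB; [exact: cvg_id|exact: cvg_cst].
  rewrite /h => s; apply: cvgB.
    apply: cvgM; last exact: cG1.
    apply: cvgM; last exact: cW.
    by apply: cvgM; [exact: cvg_cst|exact: ce].
  apply: cvgM.
    apply: cvgM; first exact: cvg_cst.
    apply: cvgB; first exact: cvg_cst.
    by apply: cvgM; exact: ce.
  apply: cvgD; first exact: cG1.
  apply: cvgM; last exact: cG2.
  by apply: cvgM; [exact: cvg_cst|exact: cW2].
Qed.

End radial_slice.

Section mean_value.
Context {R : realType} (d : nat).
Local Notation lam := (@lebesgue_measure R).
Local Notation lamd := (lebesgue_rV R d).

(** The weight that appears when 2 z_i is integrated by parts over the ball. Its integral is left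
    uncomputed: it is a common factor of all mean value estimates and cancels at the end, being
    positive. *)
Definition paraboloid_vol (r : R) : R :=
  fine (\int[lamd]_(x in eball 0 r) (r ^+ 2 - sqn x)%:E)%E.

Lemma integral_paraboloid (a : 'rV[R]_d) (r : R) : 0 < r ->
  (\int[lamd]_(x in eball a r) (r ^+ 2 - sqn (x - a))%:E =
   (paraboloid_vol r)%:E)%E.
Proof.
move=> r0.
have mq : measurable_fun setT (fun x : 'rV[R]_d => r ^+ 2 - sqn x).
  apply: measurable_funB => //.
  have : measurable_fun setT (fun x : 'rV[R]_d => sqn (x - 0)).
    by apply: measurable_sqn => //; exact: measurable_cst.
  by under eq_fun do rewrite subr0.
(* Truncation leaves the weight unchanged on the ball and makes it nonnegative everywhere, as the
   translation lemma requires. *)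
pose q (x : 'rV[R]_d) := (Num.max (r ^+ 2 - sqn x) 0)%:E.
have q0 x : (0 <= q x)%E by rewrite lee_fin le_max lexx orbT.
have mq' : measurable_fun setT q.
  by apply/measurable_EFinP; apply: measurable_maxr => //;
    exact: measurable_cst.
have qE (b : 'rV[R]_d) :
    (\int[lamd]_(x in eball b r) (r ^+ 2 - sqn (x - b))%:E =
     \int[lamd]_(x in eball b r) q (x - b)%R)%E.
  apply: eq_integral => x; rewrite inE => /(in_eball _ _ r0) xr.
  by rewrite /q max_l// subr_ge0 ltW.
have E0 : (\int[lamd]_(x in eball 0 r) (r ^+ 2 - sqn x)%:E =
    \int[lamd]_(x in eball 0 r) q x)%E.
  have := qE 0; under eq_integral do rewrite subr0.
  by under [X in _ = X -> _]eq_integral do rewrite subr0.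
rewrite qE ge0_integral_eball_translate// /paraboloid_vol E0 fineK//.
rewrite ge0_fin_numE ?integral_ge0//.
apply: (@le_lt_trans _ _ (\int[lamd]_(x in eball 0%R r) (r ^+ 2)%:E)%E).
  apply: ge0_le_integral => //.
  - exact: measurable_eball.
  - exact: measurable_funTS.
  - by move=> x _; rewrite lee_fin ge_max sqr_ge0 andbT lerBlDr lerDl sqn_ge0.
by rewrite integral_cst_eball// ltry.
Qed.

Lemma paraboloid_vol_gt0 (r : R) : (0 < d)%N -> 0 < r -> 0 < paraboloid_vol r.
Proof.
move=> d0 r0; rewrite -lte_fin -(integral_paraboloid 0 r0).
have r2 : 0 < r / 2 by lra.
apply: (@lt_le_trans _ _
  (\int[lamd]_(x in eball 0%R (r / 2)) (r ^+ 2 / 2)%:E)%E).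
  rewrite integral_cst_eball// lte_fin mulr_gt0 ?vol_gt0//.
  by rewrite divr_gt0// exprn_gt0.
have msq : measurable_fun setT (fun x : 'rV[R]_d => sqn (x - 0)).
  by apply: measurable_sqn => //; exact: measurable_cst.
have sub : eball 0 (r / 2) `<=` eball (0 : 'rV[R]_d) r.
  by move=> x; rewrite /eball/= => /lt_le_trans; apply; lra.
apply: (@le_trans _ _ (\int[lamd]_(x in eball 0%R (r / 2)) (r ^+ 2 - sqn (x -
  0))%:E)%E).
  apply: ge0_le_integral => //.
  - exact: measurable_eball.
  - by move=> x _; rewrite lee_fin divr_ge0// sqr_ge0.
  - by apply/measurable_EFinP/measurable_funTS/measurable_funB.
  - move=> x /(in_eball _ _ r2) xr; rewrite lee_fin.
    have := sqr_ge0 r; move: xr; rewrite expr_div_n; lra.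
apply: ge0_subset_integral => //.
- exact: measurable_eball.
- exact: measurable_eball.
- by apply/measurable_EFinP/measurable_funTS/measurable_funB.
- by move=> x /(in_eball _ _ r0) xr; rewrite lee_fin subr_ge0 ltW.
Qed.

(** [g1] and [g2] are the first two derivatives of [g]. They are constrained only at nonnegative
    arguments, because [g] is evaluated at squared norms and a hump is controlled only there. *)
Variables g g1 g2 : R -> R.
Hypothesis mg1 : measurable_fun setT g1.
Hypothesis mg2 : measurable_fun setT g2.
Hypothesis dg : forall v : R, 0 <= v -> is_derive v 1 g (g1 v).
Hypothesis dg1 : forall v : R, 0 <= v -> is_derive v 1 g1 (g2 v).
Hypothesis cg2 : forall v : R, 0 <= v -> {for v, continuous g2}.
Variable M : R.
Hypothesis g1M : forall v : R, 0 <= v -> `|g1 v| <= M.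
Hypothesis g2M : forall v : R, 0 <= v -> `|g2 v| <= M.

Variables (y0 c : 'rV[R]_d) (r : R).
Hypothesis r0 : 0 < r.

Let b (i : 'I_d) : R := y0 ord0 i - c ord0 i.
Let z (i : 'I_d) (y : 'rV[R]_d) : R := y ord0 i - y0 ord0 i.
Let w (i : 'I_d) (t : R) (y : 'rV[R]_d) : R := b i + t * z i y.
Let N (t : R) y : R := \sum_i w i t y ^+ 2.
Let q (y : 'rV[R]_d) : R := r ^+ 2 - sqn (y - y0).

Let N0 (t : R) y : 0 <= N t y.
Proof. by apply: sumr_ge0 => i _; exact: sqr_ge0. Qed.

Let zr i y : eball y0 r y -> `|z i y| <= r.
Proof.
move=> /(eball_sub_box r0) /(_ i); rewrite /z; exact: ltW.
Qed.

Let wr i (t : R) y : 0 <= t <= 1 -> eball y0 r y -> `|w i t y| <= `|b i| + r.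
Proof.
move=> /andP[t0 t1] By;
  rewrite /w (le_trans (ler_normD _ _))// lerD2l normrM (ger0_norm t0).
by rewrite -[leRHS]mul1r ler_pM// zr.
Qed.

(* With f x = g (|x - c|^2) and w = y0 + t (y - y0) - c, [A i t y] is
   z_i d_i f (w + c), so that the sum of the [A i] is the t-derivative of
   f (w + c); [P i t y] is (t / 2) (r^2 - |z|^2) d_i^2 f (w + c).  Since z_i is
   the derivative of - (r^2 - |z|^2) / 2, which vanishes on the sphere, [A i]
   and [P i] have the same integral over the ball. *)
Let A i (t : R) y := 2 * z i y * w i t y * g1 (N t y).
Let P i (t : R) y := t * q y * (g1 (N t y) + 2 * w i t y ^+ 2 * g2 (N t y)).

Let Ar i (t : R) y : 0 <= t <= 1 -> eball y0 r y ->
  `|A i t y| <= 2 * r * (`|b i| + r) * M.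
Proof.
move=> t01 By; rewrite /A !normrM ger0_norm//.
by rewrite !ler_pM ?mulr_ge0// ?zr ?wr ?g1M// ler_pM.
Qed.

Let q0r y : eball y0 r y -> 0 <= q y <= r ^+ 2.
Proof.
move=> /(in_eball _ _ r0) h; rewrite /q subr_ge0 (ltW h)/=.
by rewrite lerBlDr lerDl sqn_ge0.
Qed.

Let Pr i (t : R) y : 0 <= t <= 1 -> eball y0 r y ->
  `|P i t y| <= r ^+ 2 * (M + 2 * (`|b i| + r) ^+ 2 * M).
Proof.
move=> t01 By; rewrite /P normrM ler_pM//.
  have /andP[t0 t1] := t01; have /andP[q0 qr] := q0r By.
  rewrite normrM !ger0_norm// -[leRHS]mul1r ler_pM//.
rewrite (le_trans (ler_normD _ _))// lerD ?g1M//.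
rewrite normrM ler_pM ?g2M// normrM ger0_norm// ler_pM// normrX.
by rewrite ler_pXn2r ?nnegrE ?wr// addr_ge0// ltW.
Qed.

Let mcoord i : measurable_fun setT (z i).
Proof. by apply: measurable_funB => //; exact: measurable_coord. Qed.

Section joint.
Context (d' : measure_display) (T : measurableType d') (ft : T ->
  R) (fy : T -> 'rV[R]_d).
Hypothesis mft : measurable_fun setT ft.
Hypothesis mfy : measurable_fun setT fy.

Let mz i : measurable_fun setT (fun p => z i (fy p)).
Proof. exact: measurableT_comp. Qed.

Let mw i : measurable_fun setT (fun p => w i (ft p) (fy p)).
Proof. by apply: measurable_funD => //; exact: measurable_funM. Qed.

Let mN : measurable_fun setT (fun p => N (ft p) (fy p)).
Proof. by apply: measurable_sum => i; exact: measurable_funX. Qed.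

Lemma measurable_A i : measurable_fun setT (fun p => A i (ft p) (fy p)).
Proof.
apply: measurable_funM; last exact: measurableT_comp.
by apply: measurable_funM => //; apply: measurable_funM.
Qed.

Lemma measurable_P i : measurable_fun setT (fun p => P i (ft p) (fy p)).
Proof.
apply: measurable_funM.
  apply: measurable_funM => //; apply: measurable_funB => //.
  by apply: measurable_sqn.
apply: measurable_funD; first exact: measurableT_comp.
apply: measurable_funM; last exact: measurableT_comp.
by apply: measurable_funM => //; exact: measurable_funX.
Qed.

End joint.

Let iA i (t : R) : 0 <= t <= 1 -> lamd.-integrable (eball y0 r) (EFin \o A i t).
Proof.
move=> t01; apply: measurable_bounded_integrable.
- exact: measurable_eball.
- exact: eball_ltoo.
- by apply: measurable_funTS; exact: (@measurable_A _ _ (cst t) id).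
- exists (2 * r * (`|b i| + r) * M); split; first exact: num_real.
  by move=> x /ltW xM y By; exact: le_trans (Ar i t01 By) _.
Qed.

Let iP i (t : R) : 0 <= t <= 1 -> lamd.-integrable (eball y0 r) (EFin \o P i t).
Proof.
move=> t01; apply: measurable_bounded_integrable.
- exact: measurable_eball.
- exact: eball_ltoo.
- by apply: measurable_funTS; exact: (@measurable_P _ _ (cst t) id).
- exists (r ^+ 2 * (M + 2 * (`|b i| + r) ^+ 2 * M)); split;
  first exact: num_real.
  by move=> x /ltW xM y By; exact: le_trans (Pr i t01 By) _.
Qed.

Let integral_AP i (t : R) : 0 <= t <= 1 ->
  (\int[lamd]_(y in eball y0 r) (A i t y)%:E =
   \int[lamd]_(y in eball y0 r) (P i t y)%:E)%E.
Proof.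
move=> t01; have mB := measurable_eball y0 r0.
pose h y := A i t y - P i t y.
have ih : lamd.-integrable (eball y0 r) (EFin \o h).
  exact: integrableB (iA i t01) (iP i t01).
suff : (\int[lamd]_(y in eball y0 r) (h y)%:E = 0)%E.
  have fA := integrable_fin_num mB (iA i t01).
  have fP := integrable_fin_num mB (iP i t01).
  rewrite integralB_EFin//; [|exact: iA|exact: iP].
  rewrite -(fineK fA) -(fineK fP) -EFinB => -[] /eqP.
  by rewrite subr_eq0 => /eqP ->.
rewrite integral_mkcond; apply: (@integral_slice0 _ _ i).
  by apply/(integrable_mkcond _ mB).
move=> y.
pose e := y0 ord0 i.
pose Z := \sum_(j | j != i) z j y ^+ 2.
pose D := \sum_(j | j != i) w j t y ^+ 2.
pose W s := b i + t * (s - e).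
have D0 : 0 <= D by apply: sumr_ge0 => j _; exact: sqr_ge0.
have ziE s : z i (upd i y s) = s - e by rewrite /z mxE eqxx.
have zjE s j : j != i -> z j (upd i y s) = z j y.
  by move=> ji; rewrite /z mxE (negbTE ji).
have wiE s : w i t (upd i y s) = W s by rewrite /w ziE.
have NE s : N t (upd i y s) = W s ^+ 2 + D.
  rewrite /N (bigD1 i)//= wiE; congr (_ + _).
  by apply: eq_bigr => j ji; rewrite /w zjE.
have sE s : sqn (upd i y s - y0) = (s - e) ^+ 2 + Z.
  rewrite /sqn (bigD1 i)//=; congr (_ + _).
    by rewrite -ziE /z !mxE.
  by apply: eq_bigr => j ji; rewrite -(zjE s)// /z !mxE.
pose k s := 2 * (s - e) * W s * g1 (W s ^+ 2 + D) -
  t * (r ^+ 2 - Z - (s - e) ^+ 2) * (g1 (W s ^+ 2 + D) + 2 * W s ^+ 2 * g2 (W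
    s ^+ 2 + D)).
have hE s : h (upd i y s) = k s.
  by rewrite /h /A /P /q /k ziE wiE NE sE; ring.
(* The line through [y] parallel to axis [i] either misses the open ball or cuts it in an open chord
   of half-length [l], centred at [e], on which the weight [q] equals l^2 - (s - e)^2. *)
have [Zr|Zr] := lerP (r ^+ 2) Z.
  rewrite (eq_integral (cst 0)%E) ?integral0// => s _.
  rewrite /patch ifF//; apply/negbTE/negP => /set_mem/(in_eball _ _ r0).
  by rewrite sE; have := sqr_ge0 (s - e); lra.
pose l := Num.sqrt (r ^+ 2 - Z).
have l0 : 0 < l by rewrite sqrtr_gt0 subr_gt0.
have lE : r ^+ 2 - Z = l ^+ 2 by rewrite sqr_sqrtr// ltW// subr_gt0.
rewrite (_ : (fun _ => _) = (EFin \o k) \_ `]e - l, e + l[); last first.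
  apply/funext => s; rewrite /patch /= hE.
  congr (if _ then _ else _); apply/idP/idP => /set_mem h1; apply/mem_set.
    move: h1 => /(in_eball _ _ r0); rewrite sE => h1.
    have : (s - e) ^+ 2 < l ^+ 2 by rewrite -lE; lra.
    rewrite -[ltLHS]real_normK ?num_real// ltr_pXn2r ?nnegrE ?(ltW l0)//.
    by rewrite /= in_itv/= ltr_norml => /andP[? ?]; lra.
  apply/in_eball => //; rewrite sE -ltrBrDr lE.
  rewrite -[ltLHS]real_normK ?num_real// ltr_pXn2r ?nnegrE ?(ltW l0)//.
  by move: h1; rewrite /= in_itv/= ltr_norml => /andP[? ?]; lra.
(* Adding the two endpoints does not change the integral and gives the closed interval of
   [integral_radial_slice]. *)
rewrite -integral_mkcond -(integral_itv_bndoo true false); last first.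
  apply: measurable_funTS; apply/measurable_EFinP.
  have mW : measurable_fun [set: R] W.
    apply: measurable_funD => //; apply: measurable_funM => //.
    exact: measurable_funB.
  have mV : measurable_fun [set: R] (fun s => W s ^+ 2 + D).
    by apply: measurable_funD => //; exact: measurable_funX.
  have mse : measurable_fun [set: R] (fun s => s - e) by exact: measurable_funB.
  have mG1 : measurable_fun [set: R] (fun s =>
    g1 (W s ^+ 2 + D)) by exact: measurableT_comp.
  have mG2 : measurable_fun [set: R] (fun s =>
    g2 (W s ^+ 2 + D)) by exact: measurableT_comp.
  apply: measurable_funB.
    apply: measurable_funM => //; apply: measurable_funM => //.
    exact: measurable_funM.
  apply: measurable_funM.
    apply: measurable_funM => //; apply: measurable_funB => //.
    exact: measurable_funX.
  apply: measurable_funD => //; apply: measurable_funM => //.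
  by apply: measurable_funM => //; exact: measurable_funX.
rewrite -[RHS](integral_radial_slice dg1 cg2 e (b i) t D0 l0).
by apply: eq_integral => s _; rewrite /= /k lE.
Qed.

Let Phi (t : R) y := \sum_i A i t y.

Let is_derive_N (t : R) y : is_derive t 1 (fun t => g (N t y)) (Phi t y).
Proof.
have dN : is_derive t 1 (fun t => N t y) (\sum_i 2 * z i y * w i t y).
  have dw i : is_derive t 1 (fun t => w i t y ^+ 2) (2 * z i y * w i t y).
    by rewrite /w; apply: is_derive_eq; rewrite /GRing.scale/=; ring.
  rewrite /N.
  rewrite (_ : (fun t => _) = \sum_i (fun t => w i t y ^+ 2)); last first.
    by apply/funext => s; rewrite fct_sumE.
  exact: is_derive_sum.
have := @is_derive1_comp R g (fun t => N t y) t _ _ (dg (N0 t y)) dN.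
rewrite (_ : g1 _ * _ = Phi t y)//.
by rewrite mulrC big_distrl/=; apply: eq_bigr.
Qed.

Let cPhi y : continuous (Phi ^~ y).
Proof.
have cw i : continuous (fun t => w i t y).
  move=> t; apply: cvgD; first exact: cvg_cst.
  by apply: cvgM; [exact: cvg_id|exact: cvg_cst].
rewrite /Phi /A; apply: continuous_sum => i t; apply: cvgM.
  by apply: cvgM; [exact: cvg_cst|exact: cw].
apply: (@continuous_comp _ _ _ (fun t => N t y) g1).
  by apply: continuous_sum => j s; apply: cvgM; exact: cw.
by apply/differentiable_continuous/derivable1_diffP; case: (dg1 (N0 t y)).
Qed.

Let N1E y : N 1 y = sqn (y - c).
Proof. by apply: eq_bigr => i _; rewrite /w /b /z !mxE; congr (_ ^+ 2);
  ring. Qed.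

Let N0E y : N 0 y = sqn (y0 - c).
Proof. by apply: eq_bigr => i _; rewrite /w /b /z !mxE; congr (_ ^+ 2);
  ring. Qed.

Let NtE (t : R) y : N t y = sqn (y0 + t *: (y - y0) - c).
Proof. by apply: eq_bigr => i _; rewrite /w /b /z !mxE; congr (_ ^+ 2);
  ring. Qed.

(** The right-hand side of the next hypothesis is the Laplacian of g (|p - c|^2) at [p], so [m] is a
    lower bound of the Laplacian on the ball. *)
Variable m : R.
Hypothesis lapm : forall p, eball y0 r p ->
  m <= 2 * d%:R * g1 (sqn (p - c)) + 4 * sqn (p - c) * g2 (sqn (p - c)).

Let PsumE (t : R) y : \sum_i P i t y =
  t * q y * (d%:R * g1 (N t y) + 2 * N t y * g2 (N t y)).
Proof.
rewrite /P -big_distrr/=; congr (_ * _).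
rewrite big_split/= sumr_const card_ord -[g1 _ *+ _]mulr_natl; congr (_ + _).
by rewrite -big_distrl/= -big_distrr.
Qed.

Let Psum_ge (t : R) y : 0 <= t <= 1 -> eball y0 r y ->
  t * m / 2 * q y <= \sum_i P i t y.
Proof.
move=> /andP[t0 t1] By; have /andP[q0 _] := q0r By.
(* The ball is star-shaped about its centre, so the bound on the Laplacian applies at the
   intermediate point. *)
have : eball y0 r (y0 + t *: (y - y0)).
  apply/in_eball => //; rewrite addrAC subrr add0r.
  have -> : sqn (t *: (y - y0)) = t ^+ 2 * sqn (y - y0).
    rewrite /sqn big_distrr/=; apply: eq_bigr => i _.
    by rewrite !mxE exprMn.
  move: By => /(in_eball _ _ r0); apply: le_lt_trans.
  by rewrite ler_piMl ?sqn_ge0// expr_le1.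
move/lapm; rewrite -NtE => lm.
rewrite PsumE -subr_ge0.
rewrite (_ : _ - _ = t * q y *
  ((2 * d%:R * g1 (N t y) + 4 * N t y * g2 (N t y) - m) / 2)); last by field.
apply: mulr_ge0; first exact: mulr_ge0.
by apply: divr_ge0; rewrite ?subr_ge0.
Qed.

Let integral_Phi_ge (t : R) : 0 <= t <= 1 ->
  ((t * m / 2 * paraboloid_vol r)%:E <=
   \int[lamd]_(y in eball y0 r) (Phi t y)%:E)%E.
Proof.
move=> t01; have mB := measurable_eball y0 r0.
have -> : (\int[lamd]_(y in eball y0 r) (Phi t y)%:E =
    \int[lamd]_(y in eball y0 r) (\sum_i P i t y)%:E)%E.
  under eq_integral do rewrite /Phi -sumEFin.
  under [RHS]eq_integral do rewrite -sumEFin.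
  rewrite !integral_sum//.
  - by apply: eq_bigr => i _; exact: integral_AP.
  - by move=> i; exact: iP.
  - by move=> i; exact: iA.
have iq : lamd.-integrable (eball y0 r) (EFin \o q).
  apply: measurable_bounded_integrable => //.
  - exact: eball_ltoo.
  - apply: measurable_funTS; apply: measurable_funB => //.
    exact: measurable_sqn.
  - exists (r ^+ 2); split; first exact: num_real.
    move=> x /ltW xM y By; apply: le_trans xM.
    by have /andP[? ?] := q0r By; rewrite ger0_norm.
rewrite EFinM -(integral_paraboloid y0 r0) -integralZl//.
apply: le_integral => //.
- exact: integrableZl.
- under eq_fun do rewrite -sumEFin.
  by apply: integrable_sum => // i _; exact: iP.
- by move=> y; rewrite inE => By; rewrite -EFinM lee_fin; exact: Psum_ge.
Qed.

(** The increment of g (|. - c|^2) from [y0] to [y] is the integral of [Phi t y] over t in [0, 1].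
    After Fubini, integration by parts replaces [Phi t] by t / 2 times the weight times the
    Laplacian at y0 + t (y - y0); the integral of t / 2 over [0, 1] gives the factor 1 / 4. *)
Lemma radial_mean_ge :
  ((m * paraboloid_vol r / 4)%:E <=
   \int[lamd]_(y in eball y0 r) (g (sqn (y - c)) - g (sqn (y0 - c)))%:E)%E.
Proof.
have mB := measurable_eball y0 r0.
have m01 : measurable (`[0, 1] : set (measurableTypeR R))
  by exact: measurable_itv.
pose F (p : measurableTypeR R * 'rV[R]_d) : \bar R :=
  ((EFin \o (fun p => Phi p.1 p.2)) \_ (`[0, 1] `*` eball y0 r)) p.
have iF : (lam \x lamd)%E.-integrable setT F.
  have mD : measurable ((`[0, 1] : set (measurableTypeR R)) `*` eball y0 r).
    exact: measurableX.
  apply/(integrable_mkcond _ mD); apply: measurable_bounded_integrable => //.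
  - suff : (lam [set` `[0%R, 1%R]] * lamd (eball y0 r) < +oo)%E.
      by rewrite -(product_measure1E lam lamd m01 mB).
    apply: lte_mul_pinfty => //.
      by rewrite lebesgue_measure_itv/= lte_fin ltr01 -EFinB.
    exact: eball_ltoo.
  - apply: measurable_funTS; apply: measurable_sum => i.
    by apply: measurable_A.
  - exists (\sum_i 2 * r * (`|b i| + r) * M); split; first exact: num_real.
    move=> x /ltW xM [t y] [/= t01 By]; apply: le_trans xM.
    apply: (le_trans (ler_norm_sum _ _ _)).
    by apply: ler_sum => i _; apply: Ar By; move: t01; rewrite in_itv.
have FE t y : F (t, y) =
  if t \in `[0, 1] then ((EFin \o Phi t) \_ (eball y0 r)) y else 0%E.
  rewrite /F /patch in_setX/= mem_setE.
  by case: (t \in `[0, 1]).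
have := Fubini iF.
have -> : (\int[lamd]_y \int[lam]_t F (t, y) =
   \int[lamd]_(y in eball y0 r) (g (sqn (y - c)) - g (sqn (y0 - c)))%:E)%E.
  rewrite [RHS]integral_mkcond; apply: eq_integral => y _.
  rewrite /patch; case: ifPn => By.
    rewrite -(N1E y) -(N0E y).
    rewrite -(integral_is_derive (@ltr01 R) (fun t =>
      is_derive_N t y) (@cPhi y)).
    rewrite [RHS]integral_mkcond; apply: eq_integral => t _.
    rewrite FE /patch By.
    by rewrite mem_setE.
  rewrite (eq_integral (cst 0%E)) ?integral0// => t _.
  by rewrite FE /patch (negbTE By) if_same.
move=> <-.
have -> : (\int[lam]_t \int[lamd]_y F (t, y) =
    \int[lam]_(t in `[0%R, 1%R]) \int[lamd]_y F (t, y))%E.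
  rewrite [RHS]integral_mkcond; apply: eq_integral => t _.
  rewrite /patch; case: ifPn => // t01.
  rewrite (eq_integral (cst 0%E)) ?integral0// => y _.
  by rewrite FE ifF//; apply/negbTE; rewrite mem_setE in t01.
have -> : ((m * paraboloid_vol r / 4)%:E =
    \int[lam]_(t in `[0%R, 1%R]) (t * m / 2 * paraboloid_vol r)%:E)%E.
  have dH (t : R) : is_derive t 1 (fun t => m * paraboloid_vol r / 4 * t ^+ 2)
      (t * m / 2 * paraboloid_vol r).
    by apply: is_derive_eq; rewrite /GRing.scale/=; field.
  have cH : continuous (fun t : R => t * m / 2 * paraboloid_vol r).
    move=> t; apply: cvgM; last exact: cvg_cst.
    apply: cvgM; last exact: cvg_cst.
    by apply: cvgM; [exact: cvg_id|exact: cvg_cst].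
  by rewrite (integral_is_derive (@ltr01 R) dH cH); congr EFin; ring.
apply: le_integral => //.
- apply: measurable_bounded_integrable => //.
  + suff : (lam [set` `[0%R, 1%R]] < +oo)%E by [].
    by rewrite lebesgue_measure_itv/= lte_fin ltr01 -EFinB ltry.
  + apply: measurable_funTS; apply: measurable_funM => //.
    by apply: measurable_funM => //; apply: measurable_funM.
  + exists (`|m / 2 * paraboloid_vol r|); split; first exact: num_real.
    move=> x /ltW xM t; rewrite /= in_itv/= => /andP[t0 t1]; apply: le_trans xM.
    by rewrite -!mulrA normrM ler_piMl// ger0_norm.
- apply: (integrableS measurableT) => //.
  exact: (integrable_fubini_F iF).
- move=> t; rewrite inE/= in_itv/= => t01.
  rewrite (eq_integral ((EFin \o Phi t) \_ (eball y0 r))); last first.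
    by move=> y _; rewrite FE in_itv/= t01.
  by rewrite -integral_mkcond; exact: integral_Phi_ge.
Qed.

End mean_value.

(** * The smoothed fundamental function *)

Section kernel.
Context {R : realType} (d : nat).

(* The fundamental superharmonic function of R^d as a function of the squared
   norm v, normalised by [newton 1 = 0]; its derivative is - v^(-d/2) / 2. *)
Definition newton (v : R) : R :=
  if d == 2%N then - ln v / 2
  else (v `^ (1 - d%:R / 2) - 1) / (d%:R - 2).

Lemma newton1 : newton 1 = 0.
Proof. by rewrite /newton; case: ifP => _;
  rewrite ?ln1 ?powR1 ?subrr ?oppr0 mul0r. Qed.

Lemma measurable_newton : measurable_fun setT newton.
Proof.
rewrite /newton; case: (d == 2%N).
  apply: measurable_funM => //.
  by apply: measurable_funN; exact: measurable_ln.
by apply: measurable_funM => //; apply: measurable_funB.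
Qed.

Lemma is_derive_newton (v : R) : 0 < v ->
  is_derive v 1 newton (- (v `^ (- (d%:R / 2)) / 2)).
Proof.
move=> v0; rewrite /newton; case: (eqVneq d 2%N) => [->|d2].
  have dl := is_derive1_ln v0.
  rewrite divff ?pnatr_eq0// powR_inv1 ?(ltW v0)//.
  by apply: is_derive_eq; rewrite /GRing.scale/=; field; lra.
have d2' : d%:R - 2 != 0 :> R by rewrite subr_eq0 eqr_nat.
have dp := is_derive1_powR (1 - d%:R / 2) v0.
apply: is_derive_eq; rewrite /GRing.scale/= (_ : 1 - d%:R / 2 - 1 =
  - (d%:R / 2)); last by ring.
by field.
Qed.

Lemma MVT_newton (v u : R) : 0 < v -> v < u ->
  exists2 c, v < c < u & newton u - newton v =
    - (c `^ (- (d%:R / 2)) / 2) * (u - v).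
Proof.
move=> v0 vu.
have [||c] := @MVT R newton (fun c => - (c `^ (- (d%:R / 2)) / 2)) v u vu.
- by move=> x; rewrite in_itv/= => /andP[vx _]; apply: is_derive_newton; lra.
- apply: derivable_within_continuous => x; rewrite in_itv/= => /andP[vx _].
  by have [] := @is_derive_newton x; first lra.
by rewrite in_itv/= => h E; exists c.
Qed.

Lemma newton_le (v u : R) : 0 < v -> v <= u -> newton u <= newton v.
Proof.
move=> v0; rewrite le_eqVlt => /predU1P[->//|vu].
have [c /andP[vc cu] E] := MVT_newton v0 vu.
rewrite -subr_le0 E mulNr oppr_le0 mulr_ge0 ?divr_ge0 ?powR_ge0//; lra.
Qed.

(** On (0, 1] the value is nonnegative, and beyond 1 the slope is at least - 1 / 2. For d <= 2 the
    function is unbounded below; this linear bound serves all dimensions at once. *)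
Lemma newton_ge (v : R) : 0 < v -> - (v / 2) <= newton v.
Proof.
move=> v0; have [v1|v1] := lerP v 1.
  by have := newton_le v0 v1; rewrite newton1; lra.
have [c /andP[c1 cv]] := MVT_newton (@ltr01 R) v1.
rewrite newton1 subr0 => ->.
have : c `^ (- (d%:R / 2)) <= 1.
  have : c `^ (- (d%:R / 2)) <= c `^ 0.
    by rewrite ler_powR ?(ltW c1)// oppr_le0 divr_ge0.
  by rewrite powRr0.
have := powR_ge0 c (- (d%:R / 2)).
nra.
Qed.

(* As a function of the squared distance to a pole this is subharmonic on R^d,
   nonnegative, and smooth at the pole. *)
Definition hump (e v : R) : R := newton e - newton (v + e).

Lemma hump_ge0 (e v : R) : 0 < e -> 0 <= v -> 0 <= hump e v.
Proof. by move=> e0 v0; rewrite subr_ge0 newton_le//; lra. Qed.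

Lemma hump_le (e v : R) : 0 < e -> 0 <= v -> hump e v <= newton e + (v + e) / 2.
Proof. by move=> e0 v0; rewrite /hump lerD2l lerNl newton_ge//; lra. Qed.

Lemma hump_ge (e v u : R) : 0 < e -> 0 < u -> u <= v ->
  newton e - newton u <= hump e v.
Proof. by move=> e0 u0 uv; rewrite lerD2l lerN2 newton_le//; lra. Qed.

Lemma measurable_hump (e : R) : measurable_fun setT (hump e).
Proof.
apply: measurable_funB => //; apply: measurableT_comp;
  first exact: measurable_newton.
exact: measurable_funD.
Qed.

Definition hump1 (e v : R) : R := (v + e) `^ (- (d%:R / 2)) / 2.
Definition hump2 (e v : R) : R := - (d%:R / 4 * (v + e) `^ (- (d%:R / 2) - 1)).

Let is_derive_shift (e v : R) : is_derive v 1 (fun v => v + e) 1.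
Proof. by apply: is_derive_eq; rewrite addr0. Qed.

Lemma is_derive_hump (e v : R) : 0 < e -> 0 <= v ->
  is_derive v 1 (hump e) (hump1 e v).
Proof.
move=> e0 v0; have ve : 0 < v + e by lra.
have dN := @is_derive1_comp R newton (fun v => v + e) v _ _
  (is_derive_newton ve) (is_derive_shift e v).
have : is_derive v 1 (cst (newton e) - (newton \o (fun v => v + e)))
    (0 - (- ((v + e) `^ (- (d%:R / 2)) / 2) * 1)).
  exact: is_deriveB.
by rewrite mulr1 sub0r opprK.
Qed.

Lemma is_derive_hump1 (e v : R) : 0 < e -> 0 <= v ->
  is_derive v 1 (hump1 e) (hump2 e v).
Proof.
move=> e0 v0; have ve : 0 < v + e by lra.
have dN := @is_derive1_comp R (fun v => v `^ (- (d%:R / 2))) (fun v =>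
  v + e) v _ _
  (is_derive1_powR _ ve) (is_derive_shift e v).
rewrite /hump1 /hump2.
have -> : (fun v => (v + e) `^ (- (d%:R / 2)) / 2) =
    2^-1 \*: ((fun v => v `^ (- (d%:R / 2))) \o (fun v => v + e)).
  by apply/funext => x /=; rewrite mulrC.
by apply: is_derive_eq; rewrite /GRing.scale/=; field.
Qed.

Lemma continuous_hump2 (e v : R) : 0 < e -> 0 <= v ->
  {for v, continuous (hump2 e)}.
Proof.
move=> e0 v0; have ve : 0 < v + e by lra.
have dN := @is_derive1_comp R (fun v => v `^ (- (d%:R / 2) - 1)) (fun v =>
  v + e) v _ _
  (is_derive1_powR _ ve) (is_derive_shift e v).
have cN : {for v, continuous ((fun v => v `^ (- (d%:R / 2) - 1)) \o (fun v =>
  v + e))}.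
  by apply/differentiable_continuous/derivable1_diffP; case: dN.
by apply: cvgN; apply: cvgM; [exact: cvg_cst|exact: cN].
Qed.

Let powR_dec (e v a : R) : 0 < e -> 0 <= v -> a <= 0 -> (v + e) `^ a <= e `^ a.
Proof.
move=> e0 v0 a0; have ve : 0 < v + e by lra.
rewrite -[a]opprK !(powRN _ (- a)) lef_pV2 ?posrE ?powR_gt0//.
by apply: ge0_ler_powR; rewrite ?nnegrE ?oppr_ge0//; lra.
Qed.

Lemma hump1_bound (e v : R) : 0 < e -> 0 <= v ->
  `|hump1 e v| <= e `^ (- (d%:R / 2)).
Proof.
move=> e0 v0; rewrite ger0_norm ?divr_ge0 ?powR_ge0// /hump1.
have := powR_dec e0 v0 (_ : - (d%:R / 2) <= 0).
have -> : - (d%:R / 2) <= 0 :> R by rewrite oppr_le0 divr_ge0.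
by move/(_ isT); have := powR_ge0 (v + e) (- (d%:R / 2)); lra.
Qed.

Lemma hump2_bound (e v : R) : 0 < e -> 0 <= v ->
  `|hump2 e v| <= d%:R / 4 * e `^ (- (d%:R / 2) - 1).
Proof.
move=> e0 v0; rewrite normrN ger0_norm ?mulr_ge0 ?divr_ge0 ?powR_ge0//.
by rewrite ler_wpM2l ?divr_ge0//; apply: powR_dec.
Qed.

(** Writing (v + e)^(-d/2) as (v + e) times the lower power, the terms in [v] cancel. With e = s^2
    the result is, up to a constant factor, an approximate identity at scale [s]. *)
Lemma laplacian_hump (e v : R) : 0 < e -> 0 <= v ->
  2 * d%:R * hump1 e v + 4 * v * hump2 e v =
  d%:R * e * (v + e) `^ (- (d%:R / 2) - 1).
Proof.
move=> e0 v0; have ve : 0 < v + e by lra.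
have E : (v + e) `^ (- (d%:R / 2)) = (v + e) * (v + e) `^ (- (d%:R / 2) - 1).
  by rewrite powRB ?(gt_eqF ve) ?implybT// powRr1 ?(ltW ve)//; field; lra.
by rewrite /hump1 /hump2 E; field.
Qed.

(* A lower bound for the Laplacian of the hump at squared distance at most 4 e
   from the pole. *)
Definition density (e : R) : R := d%:R * e * (5 * e) `^ (- (d%:R / 2) - 1).

Lemma density_ge0 (e : R) : 0 <= e -> 0 <= density e.
Proof. by move=> e0; rewrite /density mulr_ge0 ?powR_ge0// mulr_ge0. Qed.

Lemma hump_mean_ge (e : R) (y0 c : 'rV[R]_d) (r m : R) : 0 < e -> 0 < r ->
  (forall p, eball y0 r p ->
    m <= d%:R * e * (sqn (p - c) + e) `^ (- (d%:R / 2) - 1)) ->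
  ((m * paraboloid_vol d r / 4)%:E <=
   \int[lebesgue_rV R d]_(y in eball y0 r)
      (hump e (sqn (y - c)) - hump e (sqn (y0 - c)))%:E)%E.
Proof.
move=> e0 r0 hm.
pose M := Num.max (e `^ (- (d%:R / 2))) (d%:R / 4 * e `^ (- (d%:R / 2) - 1)).
have mp a : measurable_fun setT (fun v : R => (v + e) `^ a).
  apply: (measurableT_comp (measurable_powR a)).
  exact: measurable_funD.
apply: (@radial_mean_ge R d (hump e) (hump1 e) (hump2 e) _ _ _ _ _ M) => //.
- by apply: measurable_funM => //; exact: mp.
- by apply: measurable_funN; apply: measurable_funM => //; exact: mp.
- by move=> v v0; exact: is_derive_hump.
- by move=> v v0; exact: is_derive_hump1.
- by move=> v v0; exact: continuous_hump2.
- by move=> v v0; rewrite le_max hump1_bound.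
- by move=> v v0; rewrite le_max hump2_bound ?orbT.
- by move=> p Bp; rewrite laplacian_hump ?sqn_ge0//; exact: hm.
Qed.

Lemma hump_mean_ge0 (e : R) (y0 c : 'rV[R]_d) (r : R) : 0 < e -> 0 < r ->
  (0 <= \int[lebesgue_rV R d]_(y in eball y0 r)
      (hump e (sqn (y - c)) - hump e (sqn (y0 - c)))%:E)%E.
Proof.
move=> e0 r0; have := @hump_mean_ge e y0 c r 0 e0 r0.
rewrite !mul0r; apply => p _.
by rewrite !mulr_ge0 ?powR_ge0// ltW.
Qed.

Lemma hump_mean_ge_near (s : R) (y0 c : 'rV[R]_d) : 0 < s ->
  sqn (y0 - c) < s ^+ 2 ->
  ((density (s ^+ 2) * paraboloid_vol d s / 4)%:E <=
   \int[lebesgue_rV R d]_(y in eball y0 s)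
      (hump (s ^+ 2) (sqn (y - c)) - hump (s ^+ 2) (sqn (y0 - c)))%:E)%E.
Proof.
move=> s0 yc; apply: hump_mean_ge => //; first exact: exprn_gt0.
move=> p /(in_eball _ _ s0) ps;
  rewrite /density ler_wpM2l ?mulr_ge0 ?(ltW s0)//.
have s20 : 0 < s ^+ 2 by exact: exprn_gt0.
have pc0 := sqn_ge0 (p - c).
(* Two displacements shorter than [s]; adding e = s^2 gives the 5 e in [density]. The exponent is
   negative, so the largest argument yields the smallest power. *)
have pc : sqn (p - c) <= 4 * s ^+ 2.
  by have := sqn_sub_le p y0 c; lra.
set a := _ - 1; have a0 : a <= 0.
  by rewrite subr_le0 (le_trans _ ler01)// oppr_le0 divr_ge0.
have pe : 0 < sqn (p - c) + s ^+ 2 by lra.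
have s50 : 0 < 5 * s ^+ 2 by lra.
rewrite -[a]opprK !(powRN _ (- a)) lef_pV2 ?posrE ?powR_gt0//.
by apply: ge0_ler_powR; rewrite ?nnegrE ?oppr_ge0//; lra.
Qed.

(** The powers of [s] cancel exactly: multiplying by [density d (s ^+ 2)] is dividing by s^d up to a
    constant. *)
Lemma densityE (s : R) : 0 < s ->
  density (s ^+ 2) * s ^+ d = d%:R * 5 `^ (- (d%:R / 2) - 1).
Proof.
move=> s0; rewrite /density powRM ?sqr_ge0//.
have -> : (s ^+ 2) `^ (- (d%:R / 2) - 1) = (s ^+ d * s ^+ 2)^-1.
  rewrite -exprD -!(powR_mulrn _ (ltW s0)) -powRrM -powRN; congr (_ `^ _).
  by rewrite natrD; field.
have := exprn_gt0 d s0; set A := s ^+ d => A0.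
by field; lra.
Qed.

End kernel.

(** The Laplacian of - L |x - c|^2 is the constant - 2 d L. *)
Lemma quadratic_mean_ge {R : realType} (d : nat) (y0 c : 'rV[R]_d) (r L : R) :
  0 < r -> 0 <= L ->
  ((- (2 * d%:R * L) * paraboloid_vol d r / 4)%:E <=
   \int[lebesgue_rV R d]_(y in eball y0 r)
      (- L * sqn (y - c) - - L * sqn (y0 - c))%:E)%E.
Proof.
move=> r0 L0.
have dl (v : R) : is_derive v 1 (fun v => - L * v) (cst (- L) v).
  by apply: is_derive_eq; rewrite /GRing.scale/= mulr1.
apply: (@radial_mean_ge R d (fun v =>
  - L * v) (cst (- L)) (cst 0) _ _ _ _ _ L) => //.
- by move=> v _; exact: cst_continuous.
- by move=> v _; rewrite /= normrN ger0_norm.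
- by move=> v _; rewrite /= normr0.
- by move=> p _ /=; rewrite mulr0 addr0; lra.
Qed.

(** * Potentials *)

Section potential_estimate.
Context {R : realType} (d : nat) (d0 : (0 < d)%N).
Local Notation lamd := (lebesgue_rV R d).
Local Notation V := 'rV[R]_d.

Lemma indic_ge0E (X : Type) (A : set X) (x : X) : (0 <=
  (\1_A x)%:E :> \bar R)%E.
Proof. by rewrite lee_fin indicE. Qed.

Lemma measurable_eball2 (s : R) : 0 < s ->
  measurable_fun setT (fun p : V * V => (\1_(eball p.1 s) p.2 : R)).
Proof.
move=> s0.
have -> : (fun p : V * V => (\1_(eball p.1 s) p.2 : R)) =
    \1_[set p : V * V | sqn (p.2 - p.1) < s ^+ 2].
  apply/funext => p; rewrite !indicE; congr (_ : bool)%:R.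
  by apply/idP/idP => /set_mem h; apply/mem_set; apply/(in_eball _ _ s0).
apply: measurable_indic.
have mc : measurable_fun setT (fun p : V * V => sqn (p.2 - p.1)).
  exact: measurable_sqn.
have := mc measurableT _ (measurable_itv `]-oo, (s ^+ 2)%R[%R).
by rewrite setTI; congr measurable; apply/seteqP; split => x /=; rewrite in_itv.
Qed.

Lemma integral_eball_indic (m : {measure set V ->
  \bar R}) (s : R) (x : V) (f : V -> \bar R) :
  (\int[m]_(y in eball x s) f y = \int[m]_y (f y * (\1_(eball x s) y)%:E))%E.
Proof. by rewrite integral_mkcond epatch_indic. Qed.

Lemma measurable_integral_eball (s : R) (f : V -> \bar R) :
  0 < s -> measurable_fun setT f -> (forall x, (0 <= f x)%E) ->
  measurable_fun setT (fun x => \int[lamd]_(y in eball x s) f y)%E.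
Proof.
move=> s0 mf f0; under eq_fun do rewrite integral_eball_indic.
apply: (measurable_fun_fubini_tonelli_F (fun p : V * V =>
  f p.2 * (\1_(eball p.1 s) p.2)%:E)%E) => [|p]; last exact: mule_ge0.
apply: emeasurable_funM; first exact: measurableT_comp.
by apply/measurable_EFinP; exact: measurable_eball2.
Qed.

Lemma hump_integrable (e : R) (y w : V) (s : R) : 0 < e -> 0 < s ->
  lamd.-integrable (eball y s) (EFin \o (fun x => hump d e (sqn (x - w)))).
Proof.
move=> e0 s0; apply: measurable_bounded_integrable.
- exact: measurable_eball.
- exact: eball_ltoo.
- apply: measurable_funTS; apply: measurableT_comp;
  first exact: measurable_hump.
  by apply: measurable_sqn.
- exists (newton d e + (2 * s ^+ 2 + 2 * sqn (y - w) + e) / 2); split;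
  first exact: num_real.
  move=> z /ltW zM x /(in_eball _ _ s0) xs; apply: le_trans zM.
  rewrite ger0_norm ?hump_ge0 ?sqn_ge0//.
  apply: (le_trans (hump_le _ e0 (sqn_ge0 _))).
  by have := sqn_sub_le x y w; lra.
Qed.

Lemma le_integral_subcst (f : V -> R) (k m s : R) (y : V) : 0 < s ->
  lamd.-integrable (eball y s) (EFin \o f) ->
  (m%:E <= \int[lamd]_(x in eball y s) (f x - k)%:E)%E ->
  ((k * vol d s + m)%:E <= \int[lamd]_(x in eball y s) (f x)%:E)%E.
Proof.
move=> s0 fi; have mB := measurable_eball y s0.
have ki : lamd.-integrable (eball y s) (EFin \o cst k).
  apply: measurable_bounded_integrable => //; first exact: eball_ltoo.
  by exists `|k|; split => // x kx z _; exact: ltW.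
rewrite integralB_EFin// integral_cst_eball//.
have := integrable_fin_num mB fi.
by case: (integral _ _ _) => //= u _; rewrite -EFinB !lee_fin; lra.
Qed.

(** A pole within [s] of the centre brings a definite gain, any other pole brings no loss. The
    indicator joins both cases in one inequality that can be integrated in [w]. *)
Lemma hump_mean (y w : V) (s : R) : 0 < s ->
  ((hump d (s ^+ 2) (sqn (y - w)) * vol d s +
    density d (s ^+ 2) * paraboloid_vol d s / 4 * \1_(eball y s) w)%:E <=
   \int[lamd]_(x in eball y s) (hump d (s ^+ 2) (sqn (x - w)))%:E)%E.
Proof.
move=> s0; have s20 : 0 < s ^+ 2 by exact: exprn_gt0.
apply: le_integral_subcst => //; first exact: hump_integrable.
rewrite indicE; have [wB|_] := boolP (w \in _).
  rewrite mulr1; apply: hump_mean_ge_near => //.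
  by rewrite sqnC; apply/(in_eball _ _ s0); rewrite inE in wB.
by rewrite mulr0; exact: hump_mean_ge0.
Qed.

Variable mu : {finite_measure set V -> \bar R}.
Variable T : set V.
Hypothesis mT : measurable T.
Variables (a : V) (rho : R).
Hypothesis rho0 : 0 <= rho.
Hypothesis T_bounded : forall w, T w -> sqn (w - a) <= rho.

(** With the sign of a subharmonic function: this is mu(T) newton (s^2) minus the smoothed Newtonian
    potential of [mu] on [T], so lower bounds for it are upper bounds for the latter. *)
Definition potential (s : R) (x : V) : \bar R :=
  (\int[mu]_(w in T) (hump d (s ^+ 2) (sqn (x - w)))%:E)%E.

Let Lam : R := fine (mu T).

Let muT : mu T = Lam%:E.
Proof. by rewrite /Lam fineK// fin_num_measure. Qed.

Let Lam0 : 0 <= Lam. Proof. by rewrite /Lam fine_ge0. Qed.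

Let mhump2 (s : R) : measurable_fun setT (fun p : V * V =>
  (hump d (s ^+ 2) (sqn (p.1 - p.2)))%:E).
Proof.
apply/measurable_EFinP; apply: measurableT_comp; first exact: measurable_hump.
exact: measurable_sqn.
Qed.

Lemma potential_ge0 (s : R) (x : V) : 0 < s -> (0 <= potential s x)%E.
Proof.
move=> s0; apply: integral_ge0 => w _; rewrite lee_fin hump_ge0 ?sqn_ge0//.
exact: exprn_gt0.
Qed.

Lemma measurable_potential (s : R) : 0 < s -> measurable_fun setT (potential s).
Proof.
move=> s0; rewrite /potential.
pose f (p : V * V) := ((hump d (s ^+ 2) (sqn (p.1 - p.2)))%:E * (\1_T
  p.2)%:E)%E.
have -> : (fun x => \int[mu]_(w in T) (hump d (s ^+ 2) (sqn (x - w)))%:E)%E =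
    (fun x => \int[mu]_w f (x, w))%E.
  by apply/funext => x; rewrite integral_mkcond epatch_indic.
apply: (measurable_fun_fubini_tonelli_F f) => [|p]; last first.
  by rewrite mule_ge0 ?lee_fin ?hump_ge0 ?sqn_ge0 ?exprn_gt0.
apply: emeasurable_funM => //; apply/measurable_EFinP.
by apply: measurableT_comp => //; exact: measurable_indic.
Qed.

(** From [hump_le], since |x - w|^2 / 2 <= |x - a|^2 + rho and s^2 / 2 <= 1 / 2. The only term
    depending on [s] is the one that [F0] subtracts later, so the bound on [F] is uniform in the
    scale. *)
Lemma potential_le (s : R) (x : V) : 0 < s <= 1 ->
  (potential s x <= (Lam * (newton d (s ^+ 2) + sqn (x - a) + rho +
    2^-1))%:E)%E.
Proof.
move=> /andP[s0 s1]; have s20 : 0 < s ^+ 2 by exact: exprn_gt0.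
have s21 : s ^+ 2 <= 1 by rewrite expr_le1// ltW.
have hle w : T w -> hump d (s ^+ 2) (sqn (x - w)) <=
    newton d (s ^+ 2) + sqn (x - a) + rho + 2^-1.
  move=> Tw; apply: (le_trans (hump_le _ s20 (sqn_ge0 _))).
  have := sqn_sub_le x a w; have := T_bounded Tw; rewrite (sqnC w a); lra.
apply: (@le_trans _ _ (\int[mu]_(w in T) (newton d (s ^+ 2) + sqn (x - a) +
  rho + 2^-1)%:E)%E).
  apply: ge0_le_integral => //.
  - by move=> w _; rewrite lee_fin hump_ge0 ?sqn_ge0.
  - apply: measurable_funTS.
    exact: (measurableT_comp (mhump2 s) (pair1_measurable x)).
rewrite integral_cst// [X in (_ * X)%E](_ : _ = Lam%:E); last exact: muT.
by rewrite -EFinM mulrC.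
Qed.

Lemma potential_mean (s : R) (y : V) : 0 < s ->
  ((vol d s)%:E * potential s y + (density d (s ^+ 2) * paraboloid_vol d s /
    4)%:E *
     \int[mu]_(w in T) (\1_(eball y s) w)%:E <=
   \int[lamd]_(x in eball y s) potential s x)%E.
Proof.
move=> s0; have s20 : 0 < s ^+ 2 by exact: exprn_gt0.
have D0 : 0 <= density d (s ^+ 2) * paraboloid_vol d s / 4.
  by rewrite divr_ge0// mulr_ge0 ?density_ge0 ?(ltW s20)// ltW//
    paraboloid_vol_gt0.
have mh w : measurable_fun setT (fun x : V =>
  (hump d (s ^+ 2) (sqn (x - w)))%:E).
  exact: (measurableT_comp (mhump2 s) (pair2_measurable w)).
have mh' x : measurable_fun setT (fun w : V =>
  (hump d (s ^+ 2) (sqn (x - w)))%:E).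
  exact: (measurableT_comp (mhump2 s) (pair1_measurable x)).
have h0 x w : (0 <= (hump d (s ^+ 2) (sqn (x - w)))%:E)%E.
  by rewrite lee_fin hump_ge0 ?sqn_ge0.
have mI : measurable_fun setT (fun w : V => (\1_(eball y s) w)%:E : \bar R).
  by apply/measurable_EFinP; apply: measurable_indic; exact: measurable_eball.
pose f (p : V * V) := ((hump d (s ^+ 2) (sqn (p.1 - p.2)))%:E *
  (\1_T p.2)%:E * (\1_(eball y s) p.1)%:E)%E.
have f0 p : (0 <= f p)%E.
  by apply: mule_ge0 (indic_ge0E _ _); exact: mule_ge0 (indic_ge0E _ _).
have mf : measurable_fun setT f.
  apply: emeasurable_funM; last exact: (measurableT_comp mI measurable_fst).
  apply: emeasurable_funM => //; apply/measurable_EFinP.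
  by apply: measurableT_comp => //; exact: measurable_indic.
have -> : (\int[lamd]_(x in eball y s) potential s x =
    \int[lamd]_x \int[mu]_w f (x, w))%E.
  rewrite integral_mkcond epatch_indic; apply: eq_integral => x _ /=.
  rewrite /potential integral_mkcond epatch_indic/=.
  rewrite -ge0_integralZr//; last 2 first.
  - apply: emeasurable_funM => //; apply/measurable_EFinP.
    exact: measurable_indic.
  - by move=> w _; apply: mule_ge0 (indic_ge0E _ _).
rewrite (fubini_tonelli f mf f0).
have -> : (\int[mu]_w \int[lamd]_x f (x, w) =
   \int[mu]_(w in T) \int[lamd]_(x in eball y s) (hump d (s ^+ 2) (sqn (x -
     w)))%:E)%E.
  rewrite [RHS]integral_mkcond epatch_indic; apply: eq_integral => w _ /=.
  rewrite [X in _ = (X * _)%E]integral_mkcond epatch_indic/=.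
  rewrite -ge0_integralZr//; last 2 first.
  - exact: emeasurable_funM.
  - by move=> x _; apply: mule_ge0 (indic_ge0E _ _).
  by apply: eq_integral => x _; rewrite /f/= muleAC.
have V0 : 0 <= vol d s by rewrite ltW// vol_gt0.
have E1 : ((vol d s)%:E * potential s y = \int[mu]_(w in T)
    ((vol d s)%:E * (hump d (s ^+ 2) (sqn (y - w)))%:E))%E.
  by rewrite ge0_integralZl//; exact: measurable_funTS.
have E2 : ((density d (s ^+ 2) * paraboloid_vol d s / 4)%:E *
    \int[mu]_(w in T) (\1_(eball y s) w)%:E = \int[mu]_(w in T)
    ((density d (s ^+ 2) * paraboloid_vol d s / 4)%:E * (\1_(eball y s)
      w)%:E))%E.
  by rewrite ge0_integralZl//; exact: measurable_funTS.
rewrite E1 E2.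
rewrite -ge0_integralD//; last 4 first.
- by move=> w _; rewrite mule_ge0.
- by apply: measurable_funTS; exact: measurable_funeM.
- by move=> w _; apply: mule_ge0 (indic_ge0E _ _).
- by apply: measurable_funTS; exact: measurable_funeM.
apply: ge0_le_integral => //.
- by move=> w _; apply: adde_ge0; apply: mule_ge0 => //; exact: indic_ge0E.
- by apply: measurable_funTS; apply: emeasurable_funD; exact: measurable_funeM.
- apply: measurable_funTS.
  under eq_fun do rewrite integral_mkcond epatch_indic/=.
  apply: (measurable_fun_fubini_tonelli_G (fun p : V * V =>
    (hump d (s ^+ 2) (sqn (p.1 - p.2)))%:E * (\1_(eball y s) p.1)%:E)%E).
    by apply: emeasurable_funM => //;
      exact: (measurableT_comp mI measurable_fst).
  by move=> p; apply: mule_ge0 (indic_ge0E _ _).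
- move=> w _; rewrite -!EFinM -EFinD mulrC [X in _ + X]mulrC mulrC.
  apply: le_trans (hump_mean y w s0); rewrite lee_fin.
  by rewrite [leLHS]addrC; lra.
Qed.

End potential_estimate.

(** * The estimate uniform in the scale *)

Section main_estimate.
Context {R : realType} (d : nat) (d0 : (0 < d)%N).
Local Notation lamd := (lebesgue_rV R d).
Local Notation V := 'rV[R]_d.

Variable mu : {finite_measure set V -> \bar R}.
Variable T : set V.
Hypothesis mT : measurable T.
Variables (a : V) (rho : R).
Hypothesis rho0 : 0 <= rho.
Hypothesis T_bounded : forall w, T w -> sqn (w - a) <= rho.
Let Lam : R := fine (mu T).
Let Lam0 : 0 <= Lam. Proof. by rewrite /Lam fine_ge0. Qed.

Variables (r C : R).
Hypothesis r0 : 0 < r.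
(** Equivalently, [C] bounds the smoothed Newtonian potential of [mu] on [T] from above, near [a]
    and at all small scales. *)
Hypothesis potential_ge : forall s x, 0 < s <= 1 -> s <= r ->
  eball a (2 * r) x ->
  ((Lam * newton d (s ^+ 2) - C)%:E <= potential mu T s x)%E.

Variable v : V -> \bar R.
Hypothesis mv : measurable_fun setT v.
Hypothesis v0 : forall x, (0 <= v x)%E.
Hypothesis v_lty : (\int[lamd]_x v x < +oo)%E.
Hypothesis v_mean : forall s x, 0 < s -> s <= r -> eball a (3 * r) x ->
  (\int[lamd]_(y in eball x s) v y <= (vol d s)%:E * v x)%E.

(* L is chosen so that the function [F] below is nonpositive off
   [eball a (3 * r)] while it is nonnegative on [eball a (2 * r)]. *)
Let L : R := (`|C| + Lam * (rho + 2^-1)) / (5 * r ^+ 2) + 2 * Lam.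

Let r20 : 0 < r ^+ 2. Proof. exact: exprn_gt0. Qed.

(** This says that the upper bound [F_le] is nonpositive at |x - a| = 3 r, with 5 = 9 - 4; [LLam]
    extends this to larger distances. *)
Let L_ge : C + Lam * (rho + 2^-1) + 9 * Lam * r ^+ 2 <= 5 * L * r ^+ 2.
Proof.
have -> : 5 * L * r ^+ 2 = `|C| + Lam * (rho + 2^-1) + 10 * Lam * r ^+ 2.
  by rewrite /L; field; rewrite gt_eqF.
have := ler_norm C; have := mulr_ge0 Lam0 (ltW r20); lra.
Qed.

Let LLam : Lam <= L.
Proof.
rewrite /L; have : 0 <= (`|C| + Lam * (rho + 2^-1)) / (5 * r ^+ 2).
  by rewrite divr_ge0 ?addr_ge0// ?mulr_ge0 ?addr_ge0// ltW.
by have := Lam0; lra.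
Qed.

Let L0 : 0 <= L. Proof. exact: le_trans LLam. Qed.

Section scale.
Variable s : R.
Hypothesis s0 : 0 < s.
Hypothesis s1 : s <= 1.
Hypothesis sr : s <= r.

Let s01 : 0 < s <= 1. Proof. by rewrite s0. Qed.

Let J (x : V) : R := fine (potential mu T s x).

Let JE x : (J x)%:E = potential mu T s x.
Proof.
rewrite /J fineK// ge0_fin_numE; last exact: potential_ge0.
exact: le_lt_trans (potential_le mu mT T_bounded x s01) (ltry _).
Qed.

Let J0 x : 0 <= J x. Proof. by rewrite -lee_fin JE potential_ge0. Qed.

Let J_le x : J x <= Lam * (newton d (s ^+ 2) + sqn (x - a) + rho + 2^-1).
Proof. by rewrite -lee_fin JE; exact: potential_le. Qed.

Let mJ : measurable_fun setT J.
Proof. by apply: measurableT_comp => //; exact: measurable_potential. Qed.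

Let msq : measurable_fun setT (fun x : V => sqn (x - a)).
Proof. by apply: measurable_sqn. Qed.

(* The test function [psi] is bounded, supported in [eball a (3 * r)], and up to
   the quadratic term its mean over [eball y s] exceeds [psi y] by a multiple of
   the mass [n y] of the ball. *)
Let F0 (x : V) : R := C + 4 * L * r ^+ 2 - Lam * newton d (s ^+ 2).
Let F (x : V) : R := F0 x + J x + - L * sqn (x - a).
Let mF0 : measurable_fun setT F0. Proof. exact: measurable_cst. Qed.

Let psi (x : V) : R := Num.max (F x) 0.

Let mF : measurable_fun setT F.
Proof.
apply: measurable_funD; last by apply: measurable_funM => //; exact: msq.
by apply: measurable_funD => //; exact: measurable_cst.
Qed.

Let mpsi : measurable_fun setT psi.
Proof. exact: measurable_maxr. Qed.

Let psi0 x : 0 <= psi x. Proof. by rewrite /psi le_max lexx orbT. Qed.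

Let F_le x : F x <= C + 4 * L * r ^+ 2 + Lam * (rho + 2^-1) + (Lam - L) * sqn
  (x - a).
Proof. by rewrite /F /F0; have := J_le x; lra. Qed.

Let psi_out x : ~ eball a (3 * r) x -> psi x = 0.
Proof.
have r3 : 0 < 3 * r by rewrite mulr_gt0.
move=> xr; rewrite /psi max_r// (le_trans (F_le _))//.
have : 9 * r ^+ 2 <= sqn (x - a).
  rewrite leNgt; apply/negP => h; apply: xr; apply/(in_eball _ _ r3).
  by have -> : (3 * r) ^+ 2 = 9 * r ^+ 2 by ring.
by have := L_ge; have := LLam; nra.
Qed.

Let F_ge x : eball a (2 * r) x -> 0 <= F x.
Proof.
move=> xr; have := potential_ge s01 sr xr; rewrite -JE lee_fin.
have r2 : 0 < 2 * r by rewrite mulr_gt0.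
have /(in_eball _ _ r2) := xr; rewrite exprMn => h.
(* On this ball the summand 4 L r^2 of [F0] outweighs L |x - a|^2, and [C] makes up for the bound on
   the potential. *)
rewrite /F /F0; have := L0; nra.
Qed.

Let K : R := Num.max (C + 4 * L * r ^+ 2 + Lam * (rho + 2^-1)) 0.

Let psi_le x : psi x <= K.
Proof.
rewrite /psi /K ge_max !le_max lexx !orbT andbT; apply/orP; left.
rewrite (le_trans (F_le _))// gerDl mulr_le0_ge0 ?sqn_ge0//.
by rewrite subr_le0.
Qed.

Let ipsi y : lamd.-integrable (eball y s) (EFin \o psi).
Proof.
apply: measurable_bounded_integrable.
- exact: measurable_eball.
- exact: eball_ltoo.
- exact: measurable_funTS.
- exists K; split; first exact: num_real.
  by move=> x /ltW xM y' _; apply: le_trans xM; rewrite ger0_norm.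
Qed.

Let iF0 y : lamd.-integrable (eball y s) (EFin \o F0).
Proof.
apply: measurable_bounded_integrable => //.
- exact: measurable_eball.
- exact: eball_ltoo.
- exact: measurable_funTS.
- exists (`|F0 a|); split; first exact: num_real.
  by move=> x /ltW xM y' _.
Qed.

Let sqn_eball x y : eball y s x -> sqn (x - a) <= 2 * s ^+ 2 + 2 * sqn (y - a).
Proof. by move=> /(in_eball _ _ s0); have := sqn_sub_le x y a; lra. Qed.

Let iJ y : lamd.-integrable (eball y s) (EFin \o J).
Proof.
apply: measurable_bounded_integrable.
- exact: measurable_eball.
- exact: eball_ltoo.
- exact: measurable_funTS.
- exists (Lam * (newton d (s ^+ 2) + (2 * s ^+ 2 + 2 * sqn (y - a)) + rho +
  2^-1)).
  split; first exact: num_real.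
  move=> x /ltW xM y' By'; apply: le_trans xM; rewrite ger0_norm//.
  rewrite (le_trans (J_le _))// ler_wpM2l// !lerD2r lerD2l.
  exact: sqn_eball.
Qed.

Let iq y : lamd.-integrable (eball y s) (EFin \o (fun x => - L * sqn (x - a))).
Proof.
apply: measurable_bounded_integrable.
- exact: measurable_eball.
- exact: eball_ltoo.
- by apply: measurable_funTS; exact: measurable_funM.
- exists (L * (2 * s ^+ 2 + 2 * sqn (y - a))).
  split; first exact: num_real.
  move=> x /ltW xM y' By'; apply: le_trans xM;
    rewrite normrM normrN !ger0_norm ?sqn_ge0//.
  by rewrite ler_wpM2l// sqn_eball.
Qed.

Let iF y : lamd.-integrable (eball y s) (EFin \o F).
Proof.
have mB := measurable_eball y s0.
exact: integrableD (integrableD mB (iF0 y) (iJ y)) (iq y).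
Qed.

Let S := paraboloid_vol d s / 4.
Let D := density d (s ^+ 2).
Let n (y : V) : \bar R := (\int[mu]_(w in T) (\1_(eball y s) w)%:E)%E.

Let S0 : 0 < S. Proof. by rewrite divr_gt0// paraboloid_vol_gt0. Qed.

Let D0 : 0 <= D. Proof. exact/density_ge0/sqr_ge0. Qed.

Let n0 y : (0 <= n y)%E. Proof. exact: integral_ge0. Qed.

Let mean_F y :
  ((vol d s * F y - 2 * d%:R * L * S)%:E + (D * S)%:E * n y <=
   \int[lamd]_(x in eball y s) (F x)%:E)%E.
Proof.
have mB := measurable_eball y s0.
have -> : (\int[lamd]_(x in eball y s) (F x)%:E =
  \int[lamd]_(x in eball y s) (F0 x)%:E +
  \int[lamd]_(x in eball y s) (J x)%:E +
  \int[lamd]_(x in eball y s) (- L * sqn (x - a))%:E)%E.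
  rewrite -(integralD_EFin mB (iF0 y) (iJ y)).
  by rewrite -(integralD_EFin mB (integrableD mB (iF0 y) (iJ y)) (iq y)).
have h1 := le_integral_subcst s0 (iq y) (quadratic_mean_ge y a s0 L0).
have h2 := potential_mean d0 mu mT y s0.
have -> : (\int[lamd]_(x in eball y s) (F0 x)%:E = (F0 y * vol d s)%:E)%E.
  by rewrite -(integral_cst_eball y _ s0).
have -> : (\int[lamd]_(x in eball y s) (J x)%:E =
    \int[lamd]_(x in eball y s) potential mu T s x)%E.
  by apply: eq_integral => x _; rewrite JE.
rewrite -addeA; apply: le_trans (leeD2l _ (leeD h2 h1)).
rewrite -JE -[density d _ * _ / _]mulrA -/D -/S -/(n y).
rewrite [X in (_ <= _ + X)%E]addeAC addeA -EFinM -!EFinD leeD2r// lee_fin.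
by rewrite /F /S; lra.
Qed.

(** Where F < 0 the positive part loses the gain coming from [n]. Since F >= 0 on [eball a (2 * r)],
    cutting [n] off to that ball leaves an inequality valid at every [y]. The term added on the
    right pays for the quadratic part. *)
Let mean_psi y :
  ((vol d s * psi y)%:E + (D * S)%:E * (n y * (\1_(eball a (2 * r)) y)%:E) <=
   \int[lamd]_(x in eball y s) (psi x)%:E + (2 * d%:R * L * S)%:E)%E.
Proof.
have c0 : 0 <= 2 * d%:R * L * S
  by rewrite mulr_ge0 ?(ltW S0)// mulr_ge0// mulr_ge0.
have [Fy|Fy] := lerP 0 (F y); last first.
  rewrite {1}/psi (max_r (ltW Fy)) mulr0 add0e indicE memNset ?mulr0 ?mule0;
    last first.
    by move=> /F_ge; lra.
  by rewrite ?mule0 adde_ge0//; apply: integral_ge0 => x _; rewrite lee_fin.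
rewrite -leeBlDr//.
apply: (@le_trans _ _ (\int[lamd]_(x in eball y s) (F x)%:E)%E); last first.
  apply: le_integral => //.
  - exact: measurable_eball.
  - by move=> x _; rewrite lee_fin /psi le_max lexx.
apply: le_trans (mean_F y).
rewrite /psi max_l// addeAC; apply: leeD; first by rewrite EFinB.
apply: lee_wpmul2l; first by rewrite lee_fin mulr_ge0 ?(ltW S0).
by rewrite indicE; case: (_ \in _); rewrite ?mule1// mule0.
Qed.

Let mn : measurable_fun setT n.
Proof.
rewrite /n; under eq_fun do rewrite integral_mkcond epatch_indic/=.
apply: (measurable_fun_fubini_tonelli_F (fun p : V * V =>
    (\1_(eball p.1 s) p.2)%:E * (\1_T p.2)%:E)%E); last by move=> p;
      exact: mule_ge0.
apply: emeasurable_funM; apply/measurable_EFinP; first exact: measurable_eball2.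
by apply: measurableT_comp => //; exact: measurable_indic.
Qed.

Let mind (A : set V) : measurable A ->
  measurable_fun setT (fun y => (\1_A y)%:E : \bar R).
Proof. by move=> mA; apply/measurable_EFinP; exact: measurable_indic. Qed.

(** Tonelli moves the average from [psi] to [v] by the symmetry [indic_eballC]. The supermean
    property of [v] is then needed only where [psi] is nonzero, that is inside [eball a (3 * r)]. *)
Let exchange :
  (\int[lamd]_y (v y * \int[lamd]_(x in eball y s) (psi x)%:E) <=
   \int[lamd]_x (v x * (vol d s * psi x)%:E))%E.
Proof.
pose f (p : V * V) := (v p.1 * ((psi p.2)%:E * (\1_(eball p.1 s) p.2)%:E))%E.
have f0 p : (0 <= f p)%E.
  by apply: mule_ge0 => //; apply: mule_ge0 => //; rewrite lee_fin.
have mf : measurable_fun setT f.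
  apply: emeasurable_funM; first exact: measurableT_comp.
  apply: emeasurable_funM; apply/measurable_EFinP;
    first exact: measurableT_comp.
  exact: measurable_eball2.
have -> : (\int[lamd]_y (v y * \int[lamd]_(x in eball y s) (psi x)%:E) =
    \int[lamd]_y \int[lamd]_x f (y, x))%E.
  apply: eq_integral => y _; rewrite integral_eball_indic -ge0_integralZl//.
  - apply: emeasurable_funM; first exact/measurable_EFinP.
    exact: mind (measurable_eball y s0).
  - by move=> x _; apply: mule_ge0 => //; rewrite lee_fin.
rewrite (fubini_tonelli f mf f0); apply: ge0_le_integral => //.
- by move=> x _; exact: integral_ge0.
- exact: (measurable_fun_fubini_tonelli_G f).
- apply: emeasurable_funM => //; apply/measurable_EFinP.
  exact: measurable_funM.
move=> x _; rewrite /f/=.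
have -> : (\int[lamd]_y (v y * ((psi x)%:E * (\1_(eball y s) x)%:E)) =
    (psi x)%:E * \int[lamd]_(y in eball x s) v y)%E.
  rewrite integral_eball_indic -ge0_integralZl//; first last.
  - by rewrite lee_fin.
  - by move=> y _; exact: mule_ge0.
  - by apply: emeasurable_funM => //; apply: mind; exact: measurable_eball.
  by apply: eq_integral => y _; rewrite muleCA indic_eballC.
have [xr|xr] := pselect (eball a (3 * r) x); last first.
  by rewrite psi_out// mul0e mulr0 mule0.
rewrite mulrC EFinM muleCA lee_wpmul2l ?lee_fin//.
by rewrite muleC; exact: v_mean.
Qed.

Lemma scale_estimate :
  ((density d (s ^+ 2))%:E *
     \int[mu]_(w in T `&` eball a r) \int[lamd]_(y in eball w s) v y <=
   (2 * d%:R * L)%:E * \int[lamd]_x v x)%E.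
Proof.
have V0 : 0 <= vol d s by rewrite ltW// vol_gt0.
have r2 : 0 < 2 * r by rewrite mulr_gt0.
pose X := (\int[lamd]_x (v x * (vol d s * psi x)%:E))%E.
pose Y := (\int[lamd]_y (v y * (n y * (\1_(eball a (2 * r)) y)%:E)))%E.
have mvp : measurable_fun setT (fun x => v x * (vol d s * psi x)%:E)%E.
  by apply: emeasurable_funM => //; apply/measurable_EFinP;
    exact: measurable_funM.
have mn2 : measurable_fun setT (fun y => n y * (\1_(eball a (2 * r)) y)%:E)%E.
  by apply: emeasurable_funM => //; apply: mind; exact: measurable_eball.
have n20 y : (0 <= n y * (\1_(eball a (2 * r)) y)%:E)%E by exact: mule_ge0.
(* [X] occurs on both sides of [XY] and must be finite to be cancelled. *)
have Xfin : X \is a fin_num.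
  rewrite ge0_fin_numE; last by apply: integral_ge0 => x _;
    rewrite mule_ge0// lee_fin mulr_ge0.
  apply: (@le_lt_trans _ _ ((vol d s * K)%:E * \int[lamd]_x v x)%E); last first.
    by rewrite lte_mul_pinfty// lee_fin mulr_ge0// le_max lexx orbT.
  rewrite -ge0_integralZl// ?lee_fin ?mulr_ge0// ?le_max ?lexx ?orbT//.
  apply: ge0_le_integral => //.
  - by move=> x _; rewrite mule_ge0// lee_fin mulr_ge0.
  - exact: measurable_funeM.
  - by move=> x _; rewrite muleC lee_wpmul2r// lee_fin ler_wpM2l.
have XY : (X + (D * S)%:E * Y <=
  X + (2 * d%:R * L * S)%:E * \int[lamd]_x v x)%E.
  have DS0 : (0 <= (D * S)%:E)%E by rewrite lee_fin mulr_ge0 ?(ltW S0).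
  have c0 : 0 <= 2 * d%:R * L * S
    by rewrite mulr_ge0 ?(ltW S0)// mulr_ge0// mulr_ge0.
  apply: le_trans (leeD2r _ exchange).
  rewrite /X /Y -!ge0_integralZl//; last 2 first.
  - exact: emeasurable_funM.
  - by move=> y _; exact: mule_ge0.
  have mipsi : measurable_fun setT (fun y =>
    \int[lamd]_(x in eball y s) (psi x)%:E)%E.
    apply: (measurable_integral_eball (f := fun x => (psi x)%:E)) => //.
    exact/measurable_EFinP.
  have ipsi0 y : (0 <= \int[lamd]_(x in eball y s) (psi x)%:E)%E.
    by apply: integral_ge0 => x _; rewrite lee_fin.
  rewrite -!ge0_integralD//; first last.
  - by apply: measurable_funeM; exact: emeasurable_funM.
  - by move=> y _; apply: mule_ge0 => //; exact: mule_ge0.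
  - by move=> y _; rewrite mule_ge0// lee_fin mulr_ge0.
  - exact: measurable_funeM.
  - by move=> y _; rewrite mule_ge0.
  - exact: emeasurable_funM.
  - by move=> y _; rewrite mule_ge0.
  apply: ge0_le_integral => //.
  - move=> y _; apply: adde_ge0; first by rewrite mule_ge0// lee_fin mulr_ge0.
    by apply: mule_ge0 => //; exact: mule_ge0.
  - apply: emeasurable_funD => //; apply: measurable_funeM;
    exact: emeasurable_funM.
  - apply: emeasurable_funD; [exact: emeasurable_funM|exact: measurable_funeM].
  - move=> y _; rewrite muleCA -ge0_muleDr//; last 2 first.
    + by rewrite lee_fin mulr_ge0.
    + exact: mule_ge0.
    rewrite [X in (_ <= _ + X)%E]muleC -ge0_muleDr//.
    by apply: lee_wpmul2l => //; exact: mean_psi.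
rewrite leeD2lE// in XY.
(* For [w] in [eball a r], every [y] within s <= r of [w] satisfies |y - a|^2 < 2 r^2 + 2 r^2 = (2
   r)^2, so the cut-off in [Y] does not affect these pairs. *)
have YI : (\int[mu]_(w in T `&` eball a r) \int[lamd]_(y in eball w s) v y <=
  Y)%E.
  pose f (p : V * V) := (v p.1 * (((\1_(eball p.1 s) p.2)%:E * (\1_T p.2)%:E) *
    (\1_(eball a (2 * r)) p.1)%:E))%E.
  have f0 p : (0 <= f p)%E.
    by apply: mule_ge0 => //; apply: mule_ge0 => //; exact: mule_ge0.
  have mf : measurable_fun setT f.
    apply: emeasurable_funM; first exact: measurableT_comp.
    apply: emeasurable_funM; last first.
      by apply: (measurableT_comp (mind _) measurable_fst);
        exact: measurable_eball.
    apply: emeasurable_funM; first by apply/measurable_EFinP;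
      exact: measurable_eball2.
    exact: (measurableT_comp (mind mT) measurable_snd).
  have mi (w : V) : measurable_fun setT (fun y : V =>
    (\1_(eball y s) w)%:E : \bar R).
    apply/measurable_EFinP.
    exact: (measurableT_comp (measurable_eball2 s0) (pair2_measurable w)).
  have mi' (y : V) : measurable_fun setT (fun w : V =>
    (\1_(eball y s) w)%:E : \bar R).
    exact: mind (measurable_eball y s0).
  have -> : (Y = \int[lamd]_y \int[mu]_w f (y, w))%E.
    apply: eq_integral => y _; rewrite /n integral_mkcond epatch_indic/=.
    rewrite -ge0_integralZr//; last by apply: emeasurable_funM => //;
      exact: mind.
    rewrite -ge0_integralZl//.
    - apply: emeasurable_funM => //.
      by apply: emeasurable_funM => //; exact: mind.
  rewrite (fubini_tonelli f mf f0) integral_mkcond;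
    apply: ge0_le_integral => //.
  - move=> w _; rewrite /patch; case: ifP => // _; exact: integral_ge0.
  - have mTB : measurable (T `&` eball a r).
      by apply: measurableI => //; exact: measurable_eball.
    apply/(measurable_restrictT _ mTB).
    by apply: measurable_funTS; exact: measurable_integral_eball.
  - exact: (measurable_fun_fubini_tonelli_G f).
  - move=> w _; rewrite /patch; case: ifPn => [|_]; last exact: integral_ge0.
    rewrite inE => -[Tw wr]; rewrite integral_eball_indic;
      apply: ge0_le_integral => //.
    + by move=> y _; exact: mule_ge0.
    + exact: emeasurable_funM.
    + exact: (measurableT_comp mf (pair2_measurable w)).
    + move=> y _; rewrite /f/= lee_wpmul2l// -!EFinM lee_fin (indic_eballC y w).
      rewrite [in leLHS]indicE; have [yw|_] := boolP (y \in _); last first.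
        by rewrite !mulr_ge0.
      rewrite !indicE yw mem_set// mem_set ?mulr1//.
      apply/(in_eball _ _ r2); rewrite inE in yw.
      move/(in_eball _ _ r0) : wr => wr; move/(in_eball _ _ s0) : yw => yw.
      have := sqn_sub_le y w a; rewrite exprMn.
      have : s ^+ 2 <= r ^+ 2 by rewrite ler_pXn2r// nnegrE ltW.
      by lra.
apply: (@le_trans _ _ (D%:E * Y)%E); first by rewrite lee_wpmul2l// lee_fin.
rewrite -(@lee_pmul2l _ S%:E) ?lte_fin//.
by rewrite !muleA -!EFinM mulrC [X in (_ <= X%:E * _)%E]mulrC.
Qed.

End scale.

Lemma main_estimate : exists C2 : R, forall s, 0 < s -> s <= 1 -> s <= r ->
  ((density d (s ^+ 2))%:E *
     \int[mu]_(w in T `&` eball a r) \int[lamd]_(y in eball w s) v y <=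
       C2%:E)%E.
Proof.
have vfin : (\int[lamd]_x v x)%E \is a fin_num.
  by rewrite ge0_fin_numE ?integral_ge0.
exists (2 * d%:R * L * fine (\int[lamd]_x v x)%E) => s s0 s1 sr.
by rewrite (EFinM (2 * d%:R * L)) fineK//; exact: scale_estimate.
Qed.

End main_estimate.

(** * Subharmonic functions and polar sets *)

Section local_topology.
Context {R : realType} (d : nat).
Local Notation V := 'rV[R]_d.
Local Notation lamd := (lebesgue_rV R d).

Lemma continuous_sqn (a : V) : continuous (fun x : V => sqn (x - a)).
Proof.
rewrite /sqn; apply: continuous_sum => i.
have cc : continuous (fun x : V => x ord0 i) by move=> x;
  exact: coord_continuous.
pose f : V -> R := (fun x : V => x ord0 i) - cst (a ord0 i).
have cf : continuous f by move=> x; apply: continuousB;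
  [exact: cc|exact: cst_continuous].
rewrite (_ : (fun x => _) = f \* f); last by apply/funext => x; rewrite /f !mxE.
by move=> x; apply: continuousM; exact: cf.
Qed.

Lemma open_eball (a : V) (s : R) : 0 < s -> open (eball a s).
Proof.
move=> s0.
have -> : eball a s = (fun x : V => sqn (x - a)) @^-1` `]-oo, (s ^+ 2)%R[.
  apply/seteqP; split => x /=; rewrite in_itv/= => h; exact/(in_eball _ _ s0).
apply: open_comp; last exact: interval_open.
by move=> x _; exact: continuous_sqn.
Qed.

Lemma eball_center (a : V) (s : R) : 0 < s -> eball a s a.
Proof.
move=> s0; apply/(in_eball _ _ s0); rewrite subrr /sqn big1 ?exprn_gt0// => i _.
by rewrite mxE expr0n.
Qed.

Lemma nbhs_eball (a : V) (s : R) : 0 < s -> nbhs a (eball a s).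
Proof. by move=> s0; apply: open_nbhs_nbhs; split;
  [exact: open_eball|exact: eball_center]. Qed.

Lemma nbhs_eballP (a : V) (W : set V) : nbhs a W ->
  exists2 s : R, 0 < s & eball a s `<=` W.
Proof.
move=> /nbhs_ballP[e /= e0 eW]; exists e => // x /(eball_sub_box e0) xe.
by apply: eW; split => // i j; rewrite (ord1 i) /ball/= distrC.
Qed.

Lemma nbhs_sub (x : V) (A B : set V) : A `<=` B -> nbhs x A -> nbhs x B.
Proof. by move=> AB; apply: filterS. Qed.

(** A Lindelöf argument: there are countably many balls with rational centre and radius 1 / (n + 1),
    and those meeting [A] in a negligible set cover [A]. Negligibility is used because [A] may fail
    to be Borel. *)
Lemma negligible_locally (mu : {measure set V -> \bar R}) (A : set V) :
  (forall x, A x -> exists2 W, nbhs x W & mu.-negligible (A `&` W)) ->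
  mu.-negligible A.
Proof.
move=> locA.
pose rad n : R := n.+1%:R^-1.
pose B (i : 'rV[rat]_d * nat) : set V := ball (map_mx ratr i.1 : V) (rad i.2).
pose F (k : nat) : set V := if unpickle k is Some i then
  (if `[< mu.-negligible (A `&` B i) >] then A `&` B i else set0) else set0.
apply: (@negligibleS _ _ _ mu (\bigcup_k F k)); last first.
  apply: negligible_bigcup => k; rewrite /F; case: unpickle => [i|].
    by case: asboolP => // _; exact: negligible_set0.
  exact: negligible_set0.
move=> x Ax; have [W /nbhs_ballP[e /= e0 eW] WA] := locA x Ax.
have [n ne] : exists n, rad n < e / 2.
  exists (Num.trunc (e / 2)^-1); rewrite /rad invf_plt ?posrE ?divr_gt0//.
  exact: truncnS_gt.
have rn0 : 0 < rad n by rewrite invr_gt0.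
have /choice[f fP] : forall j, exists q : rat, ball (ratr q :
  R) (rad n) (x ord0 j).
  move=> j.
  have /rat_in_itvoo[q'] : x ord0 j - rad n < x ord0 j + rad n by lra.
  by rewrite in_itv/= => /andP[? ?]; exists q'; rewrite /ball/= ltr_norml; lra.
pose i := (\row_j f j, n).
have Bx : B i x by split => // k j; rewrite !mxE (ord1 k); exact: fP.
exists (pickle i) => //; rewrite /F pickleK; case: asboolP => //.
case; apply: negligibleS WA => y [Ay By]; split => //; apply: eW.
exact: ball_splitr (le_ball (ltW ne) Bx) (le_ball (ltW ne) By).
Qed.

Lemma closed_supp (mu : {measure set V -> \bar R}) : closed (supp mu).
Proof.
have -> : supp mu = ~` (\bigcup_(W in [set W | open W /\ mu W = 0%E]) W).
  apply/seteqP; split => [x sx [W [oW W0] Wx]|x nx W oW Wx W0].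
    exact: sx oW Wx W0.
  by apply: nx; exists W.
by apply: open_closedC; apply: bigcup_open => W [].
Qed.

Lemma measurable_supp (mu : {measure set V -> \bar R}) : measurable (supp mu).
Proof.
rewrite -[supp mu]setCK; apply: measurableC; apply: open_measurable_rV.
by apply: closed_openC; exact: closed_supp.
Qed.

Lemma supp_null (mu : {measure set V -> \bar R}) : mu (~` supp mu) = 0%E.
Proof.
apply/negligibleP; first by apply: measurableC; exact: measurable_supp.
apply: negligible_locally => x nx.
have [W [oW Wx muW]] : exists W, [/\ open W, W x & mu W = 0%E].
  apply: contrapT => h; apply: nx => W oW Wx muW; apply: h; by exists W.
exists W; first exact: open_nbhs_nbhs.
apply: (@negligibleS _ _ _ mu W) => //.
by apply/negligibleP => //; exact: open_measurable_rV.
Qed.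

Lemma ge0_integral_supp (mu : {measure set V -> \bar R}) (O : set V) (f : V ->
  \bar R) :
  open O -> supp mu `<=` O -> measurable_fun O f -> (forall x, O x ->
    (0 <= f x)%E) ->
  (\int[mu]_(x in O) f x = \int[mu]_(x in supp mu) f x)%E.
Proof.
move=> oO sO mf f0.
rewrite (@ge0_negligible_integral _ _ _ mu O (~` supp mu))//.
- by rewrite setDE setCK setIidr.
- by apply: measurableC; exact: measurable_supp.
- exact: open_measurable_rV.
- exact: supp_null.
Qed.

Lemma compact_sqn_bounded (T : set V) (a : V) : compact T ->
  exists2 rho : R, 0 <= rho & forall w, T w -> sqn (w - a) <= rho.
Proof.
move=> cT; have /compact_bounded[M [_ hM]] : compact ((fun x =>
  sqn (x - a) : R^o) @` T).
  apply: continuous_compact => //; apply: continuous_subspaceT.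
  exact: continuous_sqn.
exists (`|M| + 1); first by rewrite addr_ge0.
move=> w Tw; rewrite -[leLHS]ger0_norm ?sqn_ge0//.
apply: (hM (`|M| + 1)); last by exists w.
by rewrite (le_lt_trans (ler_norm M))// ltrDl.
Qed.

End local_topology.

(** * Test functions, measurability and local integrability *)

Section subharmonic_functions.
Context {R : realType} (d : nat) (d0 : (0 < d)%N).
Local Notation V := 'rV[R]_d.
Local Notation lamd := (lebesgue_rV R d).

Lemma subharmonic_measurable (U : set V) (u : V -> \bar R) :
  open U -> subharmonic U u -> measurable_fun U u.
Proof.
move=> oU [_ usc _].
apply: (measurability _ (ErealGenInftyO.measurableE R)) => //.
move=> _ [_ [b ->] <-]; apply: open_measurable_rV.
rewrite (_ : _ `&` _ = [set x | U x /\ (u x < b%:E)%E]); last first.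
  by apply/seteqP; split => x /=; rewrite in_itv.
rewrite openE => x [Ux uxb]; rewrite /interior.
have := usc x Ux b uxb; have := open_nbhs_nbhs (conj oU Ux).
by apply: filterS2 => y Uy uyb; split.
Qed.

Lemma subharmonic_cst (U : set V) (k : R) : subharmonic U (fun=> k%:E).
Proof.
split => [x _|x _ b kb|x s s0 _]; first by rewrite ltry.
  by apply: nbhs_sub (nbhs_eball x ltr01) => y _.
rewrite /ball_mean integral_cst_eball// lebesgue_eball//= -EFinM.
by rewrite mulrCA mulVf ?mulr1// gt_eqF// vol_gt0.
Qed.

Lemma subharmonic_hump (U : set V) (e : R) (c : V) : 0 < e ->
  subharmonic U (fun x => (hump d e (sqn (x - c)))%:E).
Proof.
move=> e0; split => [x _|x _ b|x s s0 _]; first by rewrite ltry.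
  rewrite lte_fin => hb.
  have ch : {for x, continuous (fun x : V => hump d e (sqn (x - c)))}.
    apply: (@continuous_comp _ _ _ (fun x : V => sqn (x - c)) (hump d e)).
      exact: continuous_sqn.
    apply/differentiable_continuous/derivable1_diffP.
    by case: (is_derive_hump d e0 (sqn_ge0 (x - c))).
  have h := cvgr_lt _ ch _ hb.
  by apply: nbhs_sub (h _) => y yb; rewrite lte_fin.
have V0 := vol_gt0 d0 s0.
have := le_integral_subcst s0 (hump_integrable x c e0 s0) (hump_mean_ge0 x c
  e0 s0).
rewrite addr0 /ball_mean lebesgue_eball//= => h.
rewrite -(@lee_pmul2l _ (vol d s)%:E) ?lte_fin// -EFinM muleA -EFinM divff
  ?gt_eqF// mul1e.
by rewrite mulrC.
Qed.

Lemma subharmonic_near_lt (U : set V) (u : V -> \bar R) (x : V) :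
  open U -> subharmonic U u -> U x ->
  exists M : R, nbhs x [set y | U y /\ (u y < M%:E)%E].
Proof.
move=> oU [ulty usc _] Ux.
have [M uM] : exists M : R, (u x < M%:E)%E.
  have := ulty x Ux; case: (u x) => [k _|//|_].
    by exists (k + 1); rewrite lte_fin ltrDl.
  by exists 0; rewrite ltNyr.
exists M.
have := usc x Ux M uM; have := open_nbhs_nbhs (conj oU Ux).
by apply: filterS2 => y Uy uyb; split.
Qed.

(* If u is not integrable near x, then every small ball centred near x contains
   a fixed ball around x, so that its mean is -oo. *)
Lemma subharmonic_nonintegrable (U : set V) (u : V -> \bar R) (x : V) :
  open U -> subharmonic U u -> U x ->
  ~ (exists s : R, [/\ 0 < s, eball x s `<=` U & lamd.-integrable (eball x s)
    u]) ->
  \forall y \near x, u y = -oo%E.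
Proof.
move=> oU su Ux nint; have mu := subharmonic_measurable oU su.
have [_ _ umean] := su.
have [M] := subharmonic_near_lt oU su Ux.
move=> /nbhs_eballP[t t0 tU].
(* By [sqn_sub_le], for [y] within [s] of [x]: 2 (2 s)^2 + 2 s^2 < (4 s)^2 puts the closed ball of
   radius 2 s about [y] inside [eball x t], and 2 s^2 + 2 s^2 = (2 s)^2 puts [eball x s] inside
   [eball y (2 * s)]. *)
pose s := t / 4; have s0 : 0 < s by rewrite divr_gt0.
have ts : t = 4 * s by rewrite /s; field.
have s20 : 0 < 2 * s by rewrite mulr_gt0.
have sq16 : t ^+ 2 = 16 * s ^+ 2 by rewrite ts; ring.
have sq4 : (2 * s) ^+ 2 = 4 * s ^+ 2 by ring.
have s2p : 0 < s ^+ 2 by rewrite exprn_gt0.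
apply: nbhs_sub (nbhs_eball x s0) => y yx.
have cyU : closed_eball y (2 * s) `<=` eball x t.
  move=> z; rewrite /closed_eball/= enorm_le ?(ltW s20)// => zy.
  apply/(in_eball _ _ t0); have := sqn_sub_le z y x.
  by move/(in_eball _ _ s0) : yx => yx; lra.
have xy : eball x s `<=` eball y (2 * s).
  move=> z /(in_eball _ _ s0) zx; apply/(in_eball _ _ s20).
  have := sqn_sub_le z x y; rewrite (sqnC x y).
  by move/(in_eball _ _ s0) : yx => yx; lra.
have yU : eball y (2 * s) `<=` U.
  by move=> z zy; apply: (tU z _).1; apply: cyU; exact: ltW.
have mB := measurable_eball y s20.
have muB : measurable_fun (eball y (2 * s)) u.
  exact: measurable_funS (open_measurable_rV oU) yU mu.
have up : (\int[lamd]_(z in eball y (2 * s)) (u^\+ z) < +oo)%E.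
  apply: (@le_lt_trans _ _ (\int[lamd]_(z in eball y (2 * s)) (`|M|)%:E)%E).
    apply: ge0_le_integral => //; first exact: measurable_funepos.
    move=> z zy; rewrite funeposE ge_max lee_fin normr_ge0 andbT.
    apply: (@le_trans _ _ M%:E); last by rewrite lee_fin ler_norm.
    by apply: ltW; apply: (tU z _).2; apply: cyU; exact: ltW.
  by rewrite integral_cst_eball// ltry.
have un : (\int[lamd]_(z in eball y (2 * s)) (u^\- z) = +oo)%E.
  apply: contrapT => nun; apply: nint; exists s; split => //.
    by apply: subset_trans yU.
  apply: (integrableS mB) => //; first exact: measurable_eball.
  apply/integrableP; split => //.
  under eq_integral do rewrite -/((abse \o u) _) fune_abse.
  rewrite ge0_integralD//;
    [|exact: measurable_funepos|exact: measurable_funeneg].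
  by rewrite lte_add_pinfty// ltey; exact/eqP.
have := umean y (2 * s) s20.
rewrite /ball_mean integralE un lebesgue_eball//= addeNy.
rewrite mulrNy gtr0_sg ?mul1e ?invr_gt0 ?vol_gt0// leeNy_eq => /(_ _)/eqP;
  apply.
by move=> z /cyU /tU [].
Qed.

Lemma lebesgue_eball_gt0 (a : V) (s : R) : 0 < s -> (0 < lamd (eball a s))%E.
Proof. by move=> s0; rewrite lebesgue_eball// lte_fin vol_gt0. Qed.

Lemma not_integrable_Noo (u : V -> \bar R) (x : V) (s : R) : 0 < s ->
  (forall y, eball x s y -> u y = -oo%E) -> ~ lamd.-integrable (eball x s) u.
Proof.
move=> s0 uoo /integrableP[_].
rewrite (eq_integral (cst +oo%E)); last by move=> y; rewrite inE => /uoo ->.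
rewrite integral_cst; last exact: measurable_eball.
by rewrite gt0_mulye ?ltxx// lebesgue_eball_gt0.
Qed.

(** The points near which [u] is integrable and those near which it is -oo form two open sets
    covering [U], disjoint because balls have positive measure. By connectedness, a bad point [x]
    makes its whole component bad, including the point where [u] is not -oo. *)
Lemma subharmonic_integrable (U : set V) (u : V -> \bar R) (x : V) :
  open U -> subharmonic U u -> U x ->
  (exists2 y, connected_component U x y & u y <> -oo%E) ->
  exists s : R, [/\ 0 < s, eball x s `<=` U & lamd.-integrable (eball x s) u].
Proof.
move=> oU su Ux [y0 Cy0 uy0]; apply: contrapT => nx.
pose good := [set y : V | exists s : R,
  [/\ 0 < s, eball y s `<=` U & lamd.-integrable (eball y s) u]].
have goodN y : U y -> ~ good y -> \forall z \near y, u z = -oo%E.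
  exact: subharmonic_nonintegrable.
have open_good : open good.
  rewrite openE => y [s [s0 sU si]]; rewrite /interior.
  apply: nbhs_sub (nbhs_eball y s0) => z zy.
  have [t t0 tz] := nbhs_eballP (open_nbhs_nbhs (conj (@open_eball R d y s s0)
    zy)).
  exists t; split => //; first exact: subset_trans sU.
  by apply: integrableS si => //; exact: measurable_eball.
pose bad := [set y : V | \forall z \near y, u z = -oo%E].
have open_bad : open bad.
  rewrite openE => y; rewrite /bad /interior/= => /nbhs_eballP[s s0 sy].
  apply: nbhs_sub (nbhs_eball y s0) => z zy.
  have [t t0 tz] := nbhs_eballP (open_nbhs_nbhs (conj (@open_eball R d y s s0)
    zy)).
  apply: nbhs_sub (nbhs_eball z t0) => w wz.
  by apply: sy; exact: tz.
have badN y : bad y -> ~ good y.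
  move=> /nbhs_eballP[s s0 sy] [t [t0 tU ti]].
  pose r := Num.min s t; have r0 : 0 < r by rewrite lt_min s0.
  apply: (@not_integrable_Noo u y r) => //.
    by move=> z zr; apply: sy; apply: lt_le_trans zr _; rewrite ge_min lexx.
  apply: integrableS ti; try exact: measurable_eball.
  by move=> z zr; apply: lt_le_trans zr _; rewrite ge_min lexx orbT.
pose C := connected_component U x.
have CU : C `<=` U by exact: connected_component_sub.
have Cx : C x by exact: connected_component_refl.
have CE : C `&` bad = C.
  apply: (@component_connected _ U x).
  - by exists x; split => //; exact: goodN.
  - by exists bad.
  - exists (~` good); first exact: open_closedC.
    apply/seteqP; split => z [Cz h]; split => //; first exact: badN.
    by apply: goodN => //; exact: CU.
have : (C `&` bad) y0 by rewrite CE.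
by case=> _ /nbhs_singleton.
Qed.

End subharmonic_functions.

(** * From the uniform estimate to null sets, and from balayage to potentials *)

Section polar_sets.
Context {R : realType} (d : nat) (d0 : (0 < d)%N).
Local Notation V := 'rV[R]_d.
Local Notation lamd := (lebesgue_rV R d).

Lemma limn_einf_le (u : (\bar R)^nat) (c : \bar R) :
  (forall n, (u n <= c)%E) -> (limn_einf u <= c)%E.
Proof.
move=> uc; rewrite limn_einf_lim; apply: lime_le; first exact: is_cvg_einfs.
apply: nearW => n; apply: le_trans (uc n).
by apply: ereal_inf_lbound; exists n => /=.
Qed.

Lemma null_of_estimate (mu : {finite_measure set V -> \bar R}) (P : set V)
    (v : V -> \bar R) (r C : R) :
  0 < r -> measurable P -> measurable_fun setT v -> (forall x, (0 <= v x)%E) ->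
  (forall x (N : R), P x -> \forall y \near x, (N%:E <= v y)%E) ->
  (forall s, 0 < s -> s <= 1 -> s <= r ->
    ((density d (s ^+ 2))%:E *
     \int[mu]_(w in P) \int[lamd]_(y in eball w s) v y <= C%:E)%E) ->
  mu P = 0%E.
Proof.
move=> r0 mP mv v0 vP est.
pose s n : R := Num.min 1 r / n.+1%:R.
have m0 : 0 < Num.min 1 r by rewrite lt_min ltr01.
have s0 n : 0 < s n by rewrite divr_gt0.
have sm n : s n <= Num.min 1 r
  by rewrite ler_pdivrMr// ler_peMr ?(ltW m0)// ler1n.
have s1 n : s n <= 1 by apply: le_trans (sm n) _; rewrite ge_min lexx.
have sr n : s n <= r by apply: le_trans (sm n) _; rewrite ge_min lexx orbT.
pose I n (w : V) : \bar R := (\int[lamd]_(y in eball w (s n)) v y)%E.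
pose k : R := d%:R * 5 `^ (- (d%:R / 2) - 1).
have k0 : 0 < k by rewrite mulr_gt0 ?ltr0n// powR_gt0.
have mI n : measurable_fun setT (I n).
  exact: measurable_integral_eball.
have I0 n w : (0 <= I n w)%E by exact: integral_ge0.
pose G n w := ((density d (s n ^+ 2))%:E * I n w)%E.
have dens0 n : 0 <= density d (s n ^+ 2).
  exact/density_ge0/sqr_ge0.
have G0 n w : (0 <= G n w)%E by rewrite mule_ge0// lee_fin.
have mG n : measurable_fun P (G n).
  by apply: measurable_funTS; exact: measurable_funeM.
have Gle n : (\int[mu]_(w in P) G n w <= C%:E)%E.
  rewrite ge0_integralZl ?lee_fin//; first exact: est.
  exact: measurable_funTS.
have Goo w : P w -> limn_einf (fun n => G n w) = +oo%E.
  move=> Pw; apply: (cvg_limn_einf_sup _).1; apply/cvgeyPge => N.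
  (* By [densityE] and [vol_ge], density times volume is at least [c] at every scale, so v >= |N| /
     c near [w] forces G n w >= N for large [n]. The absolute value keeps the minorant
     nonnegative. *)
  pose c : R := k * (2 / d%:R) ^+ d.
  have c0 : 0 < c by rewrite mulr_gt0// exprn_gt0// divr_gt0// ltr0n.
  have [e e0 ev] := nbhs_eballP (vP w (`|N| / c) Pw).
  have [n0 n0e] : exists n0 : nat, s n0 < e.
    exists (Num.trunc (Num.min 1 r / e));
      rewrite /s ltr_pdivrMr// mulrC -ltr_pdivrMr//.
    exact: truncnS_gt.
  exists n0 => // n /= n0n.
  have sne : s n <= e.
    apply: le_trans (ltW n0e);
      rewrite /s ler_wpM2l ?(ltW m0)// lef_pV2 ?posrE//.
    by rewrite ler_nat.
  have In : ((`|N| / c * vol d (s n))%:E <= I n w)%E.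
    rewrite -(integral_cst_eball w _ (s0 n)); apply: ge0_le_integral => //.
    - exact: measurable_eball.
    - by move=> x _; rewrite lee_fin divr_ge0// ltW.
    - exact: measurable_funTS.
    - move=> x xw; apply: ev; exact: lt_le_trans xw sne.
  apply: (@le_trans _ _ ((density d (s n ^+ 2))%:E * (`|N| / c * vol d (s
    n))%:E)%E); last first.
    by rewrite lee_wpmul2l// lee_fin.
  rewrite -EFinM lee_fin (le_trans (ler_norm N))//.
  have := vol_ge d0 (s0 n).
  rewrite mulrCA mulrC exprMn => hv.
  have cdv : c <= density d (s n ^+ 2) * vol d (s n).
    by rewrite /c /k -(densityE d (s0 n)) -mulrA ler_wpM2l// mulrC.
  by rewrite mulrCA -[leLHS](divfK (lt0r_neq0 c0)) ler_wpM2l// divr_ge0// ltW.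
have mG' : measurable_fun P (fun x => limn_einf (G ^~ x)).
  apply: (eq_measurable_fun (cst +oo%E)) => //.
  by move=> x; rewrite inE => /Goo ->.
have := fatou mu mP mG (fun n x _ => G0 n x).
rewrite (eq_integral (cst +oo%E)); last by move=> x; rewrite inE => /Goo.
rewrite integral_cst// => /le_trans /(_ (limn_einf_le Gle)).
have [|] := ltP 0%E (mu P); last by move=> h _; apply/eqP;
  rewrite eq_le h measure_ge0.
by move=> h; rewrite gt0_mulye.
Qed.

(** The hump with pole [x] is at least newton (s^2) - newton (r^2) on the support of [theta]. The
    resulting term newton (s^2) theta(O) dominates newton (s^2) mu(O): the first factor is
    nonnegative because s <= 1, and the constant test function -1 compares the masses. *)
Lemma balayage_potential_ge (O : set V) (mu theta : {finite_measure set V ->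
  \bar R})
    (r s : R) (x : V) :
  open O -> supp mu `<=` O -> supp theta `<=` O ->
    balayage O (sbh O) theta mu ->
  0 < r -> 0 < s -> s <= 1 -> s <= r ->
  (forall w, supp theta w -> r ^+ 2 <= sqn (x - w)) ->
  ((fine (mu (supp mu)) * newton d (s ^+ 2) -
    newton d (r ^+ 2) * fine (theta (supp theta)))%:E <=
   potential mu (supp mu) s x)%E.
Proof.
move=> oO muO thO bal r0 s0 s1 sr xr.
have s20 : 0 < s ^+ 2 by exact: exprn_gt0.
have r20 : 0 < r ^+ 2 by exact: exprn_gt0.
have mO : measurable O by exact: open_measurable_rV.
have thT : theta (supp theta) = (fine (theta (supp theta)))%:E.
  by rewrite fineK// fin_num_measure//; exact: measurable_supp.
have mass (m : {finite_measure set V -> \bar R}) : supp m `<=` O ->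
    (\int[m]_(x in O) (- 1)%:E = (- fine (m (supp m)))%:E)%E.
  move=> mOs; have := @ge0_integral_supp _ _ m O (cst 1%E) oO mOs.
  rewrite !integral_cst ?mul1e//; last exact: measurable_supp.
  move=> /(_ (@measurable_cst _ _ _ _ _ _) (fun _ _ => lee01)) mE.
  have mf : m (supp m) \is a fin_num.
    by apply: fin_num_measure; exact: measurable_supp.
  rewrite mE; transitivity ((- 1)%:E * (fine (m (supp m)))%:E)%E.
    by congr (_ * _)%E; rewrite fineK.
  by rewrite -EFinM mulN1r.
have mt : fine (mu (supp mu)) <= fine (theta (supp theta)).
  have := bal _ (subharmonic_cst d0 O (- 1)%R : sbh O _).
  by rewrite !mass// lee_fin lerN2.
have n0 : 0 <= newton d (s ^+ 2).
  by rewrite -(newton1 d) newton_le// expr_le1// ltW.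
have := bal _ (subharmonic_hump d0 O x s20 : sbh O _).
have hm : measurable_fun setT (fun y : V => (hump d (s ^+ 2) (sqn (y - x)))%:E).
  apply/measurable_EFinP; apply: measurableT_comp; first exact: measurable_hump.
  exact: measurable_sqn.
have h0 (y : V) : (0 <= (hump d (s ^+ 2) (sqn (y - x)))%:E)%E
  by rewrite lee_fin hump_ge0 ?sqn_ge0.
have hmO : measurable_fun O (fun y : V => (hump d (s ^+ 2) (sqn (y - x)))%:E).
  exact: measurable_funTS.
rewrite (ge0_integral_supp oO thO hmO (fun y _ => h0 y)).
rewrite (ge0_integral_supp oO muO hmO (fun y _ => h0 y)).
rewrite /potential; under [X in (_ <= X)%E -> _]eq_integral do rewrite sqnC.
apply: le_trans.
apply: (@le_trans _ _ (\int[theta]_(w in supp theta) (newton d (s ^+ 2) -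
  newton d (r ^+ 2))%:E)%E).
  rewrite integral_cst; last exact: measurable_supp.
  rewrite [leRHS](_ : _ = ((newton d (s ^+ 2) - newton d (r ^+ 2))%:E *
    (fine (theta (supp theta)))%:E)%E); last by congr (_ * _)%E; exact: thT.
  by rewrite -EFinM lee_fin; nra.
apply: ge0_le_integral => //.
- exact: measurable_supp.
- by move=> w _; rewrite lee_fin subr_ge0 newton_le// ler_pXn2r// nnegrE ltW.
- exact: measurable_funTS.
- by move=> w /xr h; rewrite lee_fin hump_ge// sqnC.
Qed.

End polar_sets.

Lemma ball_mean_le {R : realType} (d : nat) (U : set 'rV[R]_d)
    (u : 'rV[R]_d -> \bar R) (M : R) (y : 'rV[R]_d) (s : R) :
  (0 < d)%N -> open U -> subharmonic U u -> 0 < s -> closed_eball y s `<=` U ->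
  (lebesgue_rV R d).-integrable (eball y s) u ->
  (\int[lebesgue_rV R d]_(x in eball y s) (M%:E - u x) <=
   (vol d s)%:E * (M%:E - u y))%E.
Proof.
move=> d0 oU [ulty _ umean] s0 yU ui.
have mB := measurable_eball y s0; have V0 := vol_gt0 d0 s0.
have yy : U y.
  by apply: yU; have := eball_center y s0; exact: ltW.
have iM : (lebesgue_rV R d).-integrable (eball y s) (cst M%:E).
  apply: (measurable_bounded_integrable (f := cst M)) => //;
    first exact: eball_ltoo.
  by exists `|M|; split => // l Ml z _; exact: ltW.
rewrite integralB// integral_cst_eball//.
have := umean y s s0 yU; rewrite /ball_mean lebesgue_eball//=.
have := integrable_fin_num mB ui; case: (integral _ _ _) => // k _.
have := ulty y yy; case: (u y) => [l _||_ _]//=; last first.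
  by rewrite gt0_muley ?leey// lte_fin.
rewrite -EFinM lee_fin => h; rewrite -!EFinB -EFinM lee_fin mulrBr mulrC lerB//.
by rewrite -ler_pdivlMl.
Qed.

Theorem theorem7 (R : realType) (d : nat) (d_gt0 : (0 < d)%N)
    (O : set 'rV[R]_d) (O_open : open O) (O_neq0 : O !=set0)
    (O_greenian : greenian O)
    (mu theta : {finite_measure set 'rV[R]_d -> \bar R})
    (mu_compact : compact (supp mu)) (mu_sub : supp mu `<=` O)
    (theta_compact : compact (supp theta)) (theta_sub : supp theta `<=` O)
    (mu_bal : balayage O (sbh O) theta mu)
    (E : set 'rV[R]_d) (E_polar : polar E) :
  mu.-negligible ((O `&` E) `\` supp theta).
Proof.
case: E_polar => U [u [oU EU su uC uE]].
(* The domain [U] of [u] need not be related to [O]; only a neighbourhood of [a] matters. *)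
apply: negligible_locally => a [[Oa Ea] na].
have Ua := EU a Ea.
have [t0 [t00 t0U ui]] := subharmonic_integrable d_gt0 oU su Ua (uC a Ua).
have [M nM] := subharmonic_near_lt oU su Ua.
have nth : nbhs a (~` supp theta).
  by apply: open_nbhs_nbhs; split => //; apply: closed_openC;
    exact: closed_supp.
have [t t_gt0 tM] := nbhs_eballP (filterI (filterI nM nth) (nbhs_eball a t00)).
(* Everything happens in [Q], of radius 5 r < t. Points of [eball a (3 * r)] have their balls of
   radius s <= r inside [Q], as 2 + 2 * 9 < 25; points of [eball a (2 * r)] are at distance at least
   [r] from the support of [theta], as 2 + 2 * 4 < 25. *)
pose r : R := t / 6; have r0 : 0 < r by rewrite divr_gt0.
have tr : t = 6 * r by rewrite /r; field.
have r20 : 0 < r ^+ 2 by exact: exprn_gt0.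
have r2 : 0 < 2 * r by rewrite mulr_gt0.
have r3 : 0 < 3 * r by rewrite mulr_gt0.
have r5 : 0 < 5 * r by rewrite mulr_gt0.
have r5t : 5 * r < t by rewrite tr; lra.
pose Q := eball a (5 * r).
have Qt : Q `<=` eball a t by move=> x /lt_trans; apply.
have mQ : measurable Q by exact: measurable_eball.
have QU x : Q x -> U x by move=> /Qt/tM[[[]]].
have QM x : Q x -> (u x < M%:E)%E by move=> /Qt/tM[[[]]].
have Qth x : Q x -> ~ supp theta x by move=> /Qt/tM[[]].
have uQ : (lebesgue_rV R d).-integrable Q u.
  apply: integrableS ui => //; first exact: measurable_eball.
  by move=> x /Qt/tM[].
pose v : 'rV[R]_d -> \bar R := (fun x => M%:E - u x)%E \_ Q.
have mMu : measurable_fun Q (fun x => M%:E - u x)%E.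
  by apply: emeasurable_funB => //; exact: measurable_int uQ.
have mv : measurable_fun setT v by apply/(measurable_restrictT _ mQ).
have v0 x : (0 <= v x)%E.
  rewrite /v /patch/=; case: ifPn => //; rewrite inE => /QM /ltW uM.
  case: (u x) uM => [k|//|_]; last by rewrite addey ?leey.
  by rewrite lee_fin -EFinB lee_fin subr_ge0.
have v_lty : (\int[lebesgue_rV R d]_x v x < +oo)%E.
  rewrite -integral_mkcond; apply: integrable_lty => //;
    apply: integrableB => //.
  apply: (measurable_bounded_integrable (f := cst M)) => //;
    first exact: eball_ltoo.
  by exists `|M|; split => // l Ml z _; exact: ltW.
have v_mean s x : 0 < s -> s <= r -> eball a (3 * r) x ->
    (\int[lebesgue_rV R d]_(y in eball x s) v y <= (vol d s)%:E * v x)%E.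
  move=> s0 sr /(in_eball _ _ r3) xa.
  have sr2 : s ^+ 2 <= r ^+ 2 by rewrite ler_pXn2r// nnegrE ltW.
  have xQ : closed_eball x s `<=` Q.
    move=> y; rewrite /closed_eball/= enorm_le ?(ltW s0)// => yx.
    apply/(in_eball _ _ r5); have := sqn_sub_le y x a; nra.
  have xQ' : eball x s `<=` Q by move=> y yx; apply: xQ; exact: ltW.
  have Qx : Q x by apply: xQ'; exact: eball_center.
  rewrite {2}/v /patch mem_set//.
  apply: le_trans (ball_mean_le M d_gt0 oU su s0 _ _).
  - rewrite (eq_integral (fun y => M%:E - u y)%E)// => y; rewrite inE => yx.
    by rewrite /v /patch mem_set//; exact: xQ'.
  - by move=> y /xQ /QU.
  - by apply: integrableS uQ => //; exact: measurable_eball.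
pose T := supp mu; have mT : measurable T by exact: measurable_supp.
have [rho rho0 Trho] := compact_sqn_bounded a mu_compact.
have pot s x : 0 < s <= 1 -> s <= r -> eball a (2 * r) x ->
    ((fine (mu T) * newton d (s ^+ 2) - newton d (r ^+ 2) * fine (theta (supp
      theta)))%:E
       <= potential mu T s x)%E.
  move=> /andP[s0 s1] sr /(in_eball _ _ r2) xa.
  apply: (balayage_potential_ge d_gt0 O_open mu_sub theta_sub mu_bal) => //.
  move=> w thw; rewrite leNgt; apply/negP => wx.
  apply: (Qth w) => //; apply/(in_eball _ _ r5).
  by have := sqn_sub_le w x a; rewrite (sqnC w x); nra.
have [C est] := main_estimate d_gt0 mT rho0 Trho r0 pot mv v0 v_lty v_mean.
(* [E] itself may fail to be Borel; locally it is replaced by the set where [u] is -oo, on which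
   measurability follows from that of [u] on [Q]. *)
have mP : measurable (T `&` eball a r `&` [set x | u x = -oo%E]).
  have rQ : eball a r `<=` Q by move=> x /lt_trans; apply; lra.
  have -> : T `&` eball a r `&` [set x | u x = -oo%E] =
      T `&` eball a r `&` (Q `&` u @^-1` [set -oo%E]).
    by apply/seteqP; split => x [[Tx xr] h]; split => //; [split => //;
      exact: rQ|case: h].
  apply: measurableI; first by apply: measurableI => //;
    exact: measurable_eball.
  by apply: (measurable_int _ uQ) => //; exact: emeasurable_set1.
have muP : mu (T `&` eball a r `&` [set x | u x = -oo%E]) = 0%E.
  apply: (@null_of_estimate _ _ d_gt0 mu _ v r C) => //.
  - move=> x N [[_ xr] ux].
    have Qx : Q x by apply: lt_trans xr _; lra.
    have [_ usc _] := su.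
    (* Upper semicontinuity of [u] at a point of value -oo: u < M - N nearby means v > N there. *)
    have nu : nbhs x [set y | (u y < (M - N)%:E)%E].
      by apply: usc; [exact: QU|rewrite ux ltNyr].
    have nQ : nbhs x Q by apply: open_nbhs_nbhs; split => //; exact: open_eball.
    apply: nbhs_sub (filterI nu nQ) => y [/= uy Qy].
    rewrite /v /patch mem_set//; have := QM y Qy.
    case: (u y) uy => [k||]//=; rewrite ?leey// -EFinB !lte_fin lee_fin; lra.
  - move=> s s0 s1 sr; apply: le_trans (est s s0 s1 sr).
    apply: lee_wpmul2l; first by rewrite lee_fin density_ge0 ?sqr_ge0.
    apply: ge0_subset_integral => //.
    + by apply: measurableI => //; exact: measurable_eball.
    + by apply: measurable_funTS; exact: measurable_integral_eball.
    + by move=> x _; exact: integral_ge0.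
exists (eball a r); first exact: nbhs_eball.
apply: (@negligibleS _ _ _ mu ((T `&` eball a r `&` [set x | u x =
  -oo%E]) `|` ~` T)).
  move=> x [[[Ox Ex] _] xr]; have [Tx|Tx] := pselect (T x); last by right.
  by left; split; [split|exact: uE].
apply: negligibleU; first exact/negligibleP.
by apply/negligibleP; [exact: measurableC|exact: supp_null].
Qed.
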